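(* Let $h:\mathbb R^n\to\mathbb R^d$ be a geometric linear epimorphism and let $(\Delta,h,\mathcal I)$ be a quantum fan of the form $(\Delta_b,h,\mathcal I_b)$ such that $\Gamma_{(\Delta,\mathcal I)}\simeq\Gamma_{(\Delta,\emptyset)}\times\mathbb R_{\ge0}^{\mathcal I}$ is a chamber of the secondary fan. Let $i\in\mathcal I$. On (the relative interior of) the facet $\Gamma_{(\Delta,\emptyset)}\times\mathbb R_{\ge0}^{\mathcal I\setminus\{i\}}$ of $\Gamma_{(\Delta,\mathcal I)}$ the obtained quantum fan is $(\Delta,h,\mathcal I)$, and - $\Gamma_{(\Delta,\emptyset)}\times\mathbb R_{\ge0}^{\mathcal I\setminus\{i\}}$ is a wall between $\Gamma_{(\Delta,\mathcal I)}$ and $\Gamma_{(\Delta',\mathcal I\setminus\{i\})}$, where $\Delta'$ is the star subdivision of $\Delta$ at $h(e_i)$; - the exceptional locus of the birational map $\mathscr X_{\Delta',h,\mathcal I\setminus\{i\}}\dashrightarrow\mathscr X_{\Delta,h,\mathcal I}$ is of codimension $1$.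
   Context: $h$ is geometric if $h(e_i)\ne0$ for all $i$ and $h(e_j)\notin\mathbb Rh(e_i)$ for $i\ne j$. For $b\in\mathbb R^n$ put $P_b=\{x\in\mathbb R^d\mid\langle x,h(e_i)\rangle\ge-b_i\ \forall i\}$, assumed to be a polytope of dimension $d$, and $F_{i,b}=P_b\cap\{\langle x,h(e_i)\rangle=-b_i\}$. $\mathcal I_b$ is the set of $i$ with $\dim F_{i,b}<d-1$ (virtual facets), and $\Delta_b$ is the complete fan of the cones $\sigma_Q=\operatorname{Cone}(h(e_i)\mid i\notin\mathcal I_b,\ Q\subset F_{i,b})$, $Q$ running over the faces of $P_b$. $(\Delta_b,h,\mathcal I_b)$ is a quantum fan: a fan whose rays are the $\mathbb R_{\ge0}h(e_i)$, $i\notin\mathcal I_b$, with calibration $h$ and set of virtual generators $\mathcal I_b$. Secondary fan. Let $k:\mathbb R^{n-d}\to\mathbb R^n$ be a Gale transform of $h$ (injective, with image $\ker h$). $\operatorname{CSF}(\Delta)$ is the set of functions $\varphi:|\Delta|\to\mathbb R$ linear on each cone and convex in the sense $\varphi(u+v)\ge\varphi(u)+\varphi(v)$. For $J\subset\{1,\dots,n\}$, $\Gamma_{(\Delta,J)}\subset\mathbb R^{n-d}$ is the image under $k^\top$ of $$\{b\in\mathbb R^n\mid\exists\varphi\in\operatorname{CSF}(\Delta),\ \varphi(h(e_j))=-b_j\ \forall j\notin J,\ \varphi(h(e_i))\ge-b_i\ \forall i\in J\}.$$ These cones form the secondary fan in $\operatorname{Cone}(k^\top(e_1),\dots,k^\top(e_n))$;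 its maximal cones are the chambers, and intersections of chambers are walls. Here $\mathbb R_{\ge0}^{J}$, as a factor, stands for $\operatorname{Cone}(k^\top(e_j),j\in J)$. The quantum fan obtained at $\chi\in\operatorname{Int}\operatorname{Cone}(k^\top(e_1),\dots,k^\top(e_n))$ is $(\Delta_b,h,\mathcal I_b)$ for any $b$ with $k^\top b=\chi$. Star subdivision. For $v\in|\Delta|$, the star subdivision $\Delta^*(v)$ of $\Delta$ at $v$ consists of the cones $\sigma\in\Delta$ with $v\notin\sigma$ and the cones $\operatorname{Cone}(\tau,v)$, where $v\notin\tau\in\Delta$ and $\{v\}\cup\tau\subset\sigma$ for some $\sigma\in\Delta$. Stacks. For a quantum fan $(\Delta,h,\mathcal I)$, $\mathscr S(\Delta)=\bigcup_{\sigma\text{ maximal}}\mathbb C^{\sigma(1)}\times(\mathbb C^* )^{\sigma(1)^c}\subset\mathbb C^n$, where $\sigma(1)$ is the set of $i\notin\mathcal I$ such that $\mathbb R_{\geq 0}h(e_i)$ is a ray of $\sigma$, and $\mathscr X_{\Delta,h,\mathcal I}=[\mathscr S(\Delta)/\mathbb C^{n-d}]$, where $\mathbb C^{n-d}$ acts by $t\cdot z=E(k(t))z$, $E(z_1,\dots,z_n)=(e^{2i\pi z_1},\dots,e^{2i\pi z_n})$. A combinatorial birational map $\mathscr X_{\Delta_1,h}\dashrightarrow\mathscr X_{\Delta_2,h}$ is the identity on the common open substack given by the subfan $\Delta_1\cap\Delta_2$ of common cones; its exceptional locus is the complement of this open substack in the source. *)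

(* Defs.v *)
From HB Require Import structures.
From mathcomp Require Import all_boot all_order all_algebra.
From mathcomp Require Import all_classical all_reals all_analysis.
From mathcomp Require Import complex.

Set Implicit Arguments.
Unset Strict Implicit.
Unset Printing Implicit Defensive.
Import Order.TTheory GRing.Theory Num.Theory numFieldNormedType.Exports.
Local Open Scope classical_set_scope.
Local Open Scope ring_scope.
Local Open Scope complex_scope.

Section ConvexGeometry.
Variables (R : realType) (m : nat).
Implicit Types (S C F P Q s : set 'cV[R]_m) (v x y u : 'cV[R]_m).

Definition dotv x y : R := \sum_i x i 0 * y i 0.

Definition cone_of (n : nat) (w : 'I_n -> 'cV[R]_m) (J : set 'I_n) :
    set 'cV[R]_m :=
  [set x | exists c : 'I_n -> R,
     [/\ forall j, 0 <= c j, forall j, ~ J j -> c j = 0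
       & x = \sum_j c j *: w j]].

(* [Cone(s, v)], for a convex cone s *)
Definition cone_join s v : set 'cV[R]_m :=
  [set x | exists y c, [/\ s y, 0 <= c & x = y + c *: v]].

Definition ray v : set 'cV[R]_m := [set x | exists2 c, 0 <= c & x = c *: v].

(* S contains p + 1 affinely independent points; in particular [~ dim_ge S p]
   holds for every p when S is empty *)
Definition dim_ge S (p : nat) : Prop :=
  exists2 x, S x &
    exists2 A : 'M[R]_(m, p), \rank A = p & forall j, S (x + col j A).

(* the affine hull of S has dimension p *)
Definition affine_dim S (p : nat) : Prop :=
  dim_ge S p /\ forall q, dim_ge S q -> (q <= p)%N.

Definition affine_hull S : set 'cV[R]_m :=
  [set x | exists (p : nat) (w : 'I_p -> 'cV[R]_m) (c : 'I_p -> R),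
     [/\ forall j, S (w j), \sum_j c j = 1 & x = \sum_j c j *: w j]].

Definition relative_interior S : set 'cV[R]_m :=
  [set x | S x /\ \forall y \near x, affine_hull S y -> S y].

Definition polytope_face P Q : Prop :=
  Q !=set0 /\
  exists u, Q = [set x | P x /\ forall y, P y -> dotv x u <= dotv y u].

Definition cone_face C F : Prop :=
  exists2 u, (forall x, C x -> 0 <= dotv x u)
    & F = [set x | C x /\ dotv x u = 0].

Definition cone_facet C F : Prop :=
  cone_face C F /\ exists p, affine_dim F p /\ affine_dim C p.+1.

End ConvexGeometry.

Section Fans.
Variables (R : realType) (n d : nat).
Implicit Types (h : 'M[R]_(d, n)) (k : 'M[R]_(n, n - d)) (b : 'cV[R]_n).
(* A fan is given by the set of its cones, and a cone by the set of its
   points.  The matrix h acts on columns, so that h(e_i) is [col i h]. *)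
Implicit Types (Delta : set (set 'cV[R]_d)) (I J : set 'I_n).

Definition geometric_map h : Prop :=
  (forall i, col i h != 0) /\
  forall i j, i != j -> ~ exists c : R, col j h = c *: col i h.

Definition gale_transform h k : Prop :=
  injective (fun t : 'cV[R]_(n - d) => k *m t) /\
  range (fun t : 'cV[R]_(n - d) => k *m t) = [set x | h *m x = 0].

Definition polyhedron h b : set 'cV[R]_d :=
  [set x | forall i, - b i 0 <= dotv x (col i h)].

Definition full_polytope h b : Prop :=
  bounded_set (polyhedron h b) /\ affine_dim (polyhedron h b) d.

Definition facet h b (i : 'I_n) : set 'cV[R]_d :=
  polyhedron h b `&` [set x | dotv x (col i h) = - b i 0].

Definition virtual_facets h b : set 'I_n :=
  [set i | ~ dim_ge (facet h b i) d.-1].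

Definition normal_cone h b (Q : set 'cV[R]_d) : set 'cV[R]_d :=
  cone_of (fun i => col i h)
    (~` virtual_facets h b `&` [set i | Q `<=` facet h b i]).

Definition normal_fan h b : set (set 'cV[R]_d) :=
  [set s | exists2 Q, polytope_face (polyhedron h b) Q & s = normal_cone h b Q].

(* the triple (Delta, h, I) is of the form (Delta_b, h, I_b) *)
Definition polytopal_quantum_fan h Delta I : Prop :=
  exists b, [/\ full_polytope h b, Delta = normal_fan h b
              & I = virtual_facets h b].

Definition fan_support Delta : set 'cV[R]_d := \bigcup_(s in Delta) s.

(* Functions on the support are represented by functions on the whole space,
   whose values outside the support are irrelevant for a complete fan. *)
Definition CSF Delta : set ('cV[R]_d -> R) :=
  [set phi |
    (forall s, Delta s -> exists u, forall x, s x -> phi x = dotv x u) /\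
    forall x y, fan_support Delta x -> fan_support Delta y -> fan_support Delta (x + y) ->
      phi x + phi y <= phi (x + y)].

Definition Gamma h k Delta J : set 'cV[R]_(n - d) :=
  (fun b : 'cV[R]_n => k^T *m b) @`
  [set b : 'cV[R]_n | exists2 phi, CSF Delta phi &
     (forall j, ~ J j -> phi (col j h) = - b j 0) /\
     (forall i, J i -> - b i 0 <= phi (col i h))].

(* [k^T(e_j)] *)
Definition gale_vector k (j : 'I_n) : 'cV[R]_(n - d) := col j k^T.

(* The product of A with R_{>=0}^J, realised inside R^(n-d) as the sum of A
   and of the cone on the k^T(e_j), j in J. *)
Definition cone_product k (A : set 'cV[R]_(n - d)) J : set 'cV[R]_(n - d) :=
  [set x | exists y z, [/\ A y, cone_of (gale_vector k) J z & x = y + z]].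

(* This sum is a product: (y, c) |-> y + \sum_(j in J) c_j k^T(e_j) is
   injective on A x R_{>=0}^J. *)
Definition direct_product k (A : set 'cV[R]_(n - d)) J : Prop :=
  forall y y' (c c' : 'I_n -> R), A y -> A y' ->
    (forall j, 0 <= c j) -> (forall j, 0 <= c' j) ->
    (forall j, ~ J j -> c j = 0) -> (forall j, ~ J j -> c' j = 0) ->
    y + \sum_j c j *: gale_vector k j = y' + \sum_j c' j *: gale_vector k j ->
    y = y' /\ c =1 c'.

(* The condition on J says that every ray of the fan is spanned by some h(e_j)
   with j not in J.  The cones of the secondary fan contained in the boundary
   of its support, which come from polytopes of dimension < d, are left out:
   they are not maximal. *)
Definition secondary_cone h k (C : set 'cV[R]_(n - d)) : Prop :=
  exists b J, [/\ full_polytope h b, J `<=` virtual_facets h b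
                & C = Gamma h k (normal_fan h b) J].

Definition chamber h k (C : set 'cV[R]_(n - d)) : Prop :=
  secondary_cone h k C /\
  forall C', secondary_cone h k C' -> C `<=` C' -> C' = C.

Definition wall_between h k (W C1 C2 : set 'cV[R]_(n - d)) : Prop :=
  [/\ chamber h k C1, chamber h k C2, C1 <> C2 & W = C1 `&` C2].

Definition quantum_fan_at h k (chi : 'cV[R]_(n - d)) Delta I : Prop :=
  interior (cone_of (gale_vector k) setT) chi /\
  forall b, k^T *m b = chi ->
    [/\ full_polytope h b, normal_fan h b = Delta & virtual_facets h b = I].

Definition star_subdivision Delta (v : 'cV[R]_d) : set (set 'cV[R]_d) :=
  [set s | (Delta s /\ ~ s v) \/
           exists t, [/\ Delta t, ~ t v,
             exists s', [/\ Delta s', s' v & t `<=` s'] & s = cone_join t v]].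

Definition maximal_cone Delta (s : set 'cV[R]_d) : Prop :=
  Delta s /\ forall s', Delta s' -> s `<=` s' -> s' = s.

(* [sigma(1)] *)
Definition cone_rays h I (s : set 'cV[R]_d) : set 'I_n :=
  [set i | ~ I i /\ cone_face s (ray (col i h))].

End Fans.

Section Analytic.
Variables (K : numFieldType).

(* For K = R[i], differentiability on an open set is holomorphy. *)
Definition contains_manifold (n : nat) (Z : set 'cV[K]_n) (p : nat) : Prop :=
  exists (U : set 'cV[K]_p) (f : 'cV[K]_p -> 'cV[K]_n),
    [/\ open U, U !=set0, f @` U `<=` Z
      & forall x, U x -> differentiable f x /\ injective ('d f x)].

(* The dimension of an analytic set is the largest dimension of a complex
   manifold immersed in it. *)
Definition analytic_dim (n : nat) (Z : set 'cV[K]_n) (p : nat) : Prop :=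
  contains_manifold Z p /\ forall q, contains_manifold Z q -> (q <= p)%N.

(* The quotient stack [S / K^m] is represented by its presentation, the action
   of K^m on the atlas S. *)
Record quotient_stack (n m : nat) := QuotientStack {
  atlas : set 'cV[K]_n;
  act : 'cV[K]_m -> 'cV[K]_n -> 'cV[K]_n;
  act0 : forall z, act 0 z = z;
  actD : forall s t z, act (s + t) z = act s (act t z);
  act_atlas : forall t z, atlas z -> atlas (act t z) }.

(* Substacks of [S / G] correspond to G-stable subsets of S. *)
Record substack (n m : nat) (X : quotient_stack n m) := Substack {
  locus : set 'cV[K]_n;
  locus_atlas : locus `<=` atlas X;
  locus_act : forall t z, locus z -> locus (act X t z) }.

(* dim [Z / G] = dim Z - dim G, so dim G cancels out in a codimension. *)
Definition codimension (n m : nat) (X : quotient_stack n m) (Y : substack X)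
    (r : nat) : Prop :=
  exists p q, [/\ analytic_dim (atlas X) p, analytic_dim (locus Y) q
                & p = (q + r)%N].

End Analytic.

Section QuantumStacks.
Variables (R : realType) (n d : nat).
Implicit Types (h : 'M[R]_(d, n)) (k : 'M[R]_(n, n - d)).
Implicit Types (Delta : set (set 'cV[R]_d)) (I J : set 'I_n).

Definition cexp (z : R[i]) : R[i] :=
  (expR (complex.Re z))%:C * (cos (complex.Im z) +i* sin (complex.Im z)).

Lemma cexp0 : cexp 0 = 1.
Proof. by rewrite /cexp /= expR0 cos0 sin0 mul1r. Qed.

Lemma cexpD z w : cexp (z + w) = cexp z * cexp w.
Proof.
case: z w => [a b] [a' b']; rewrite /cexp /= expRD cosD sinD mulrACA rmorphM /=.
by congr (_ * _); apply/eqP; rewrite eq_complex /= eqxx addrC eqxx.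
Qed.

Lemma cexp_neq0 z : cexp z != 0.
Proof.
apply/eqP => z0; have /eqP := cexpD z (- z).
by rewrite subrr cexp0 z0 mul0r oner_eq0.
Qed.

(* [t . z = E(k(t)) z], with k extended to C^(n-d) *)
Definition quantum_act k (t : 'cV[R[i]]_(n - d)) (z : 'cV[R[i]]_n) :
    'cV[R[i]]_n :=
  \col_j (cexp ((0 +i* (2%:R * pi)) * (map_mx (real_complex R) k *m t) j 0)
          * z j 0).

Lemma quantum_act0 k z : quantum_act k 0 z = z.
Proof.
by apply/colP => j; rewrite mxE mulmx0 mxE mulr0 cexp0 mul1r.
Qed.

Lemma quantum_actD k s t z :
  quantum_act k (s + t) z = quantum_act k s (quantum_act k t z).
Proof.
apply/colP => j; rewrite mxE mulmxDr [X in cexp (_ * X)]mxE mulrDr cexpD -mulrA.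
by rewrite [RHS]mxE; congr (_ * _); rewrite [RHS]mxE.
Qed.

Lemma quantum_act_eq0 k t z j : (quantum_act k t z j 0 == 0) = (z j 0 == 0).
Proof. by rewrite mxE mulf_eq0 (negbTE (cexp_neq0 _)). Qed.

(* [S(Delta)] *)
Definition quantum_atlas h Delta I : set 'cV[R[i]]_n :=
  [set z | exists2 s, maximal_cone Delta s &
             forall j, ~ cone_rays h I s j -> z j 0 != 0].

Lemma quantum_atlas_act h k Delta I t z :
  quantum_atlas h Delta I (quantum_act k t z) <-> quantum_atlas h Delta I z.
Proof.
by split=> -[s ms sz]; exists s => // j /sz; rewrite quantum_act_eq0.
Qed.

Definition quantum_stack h k Delta I : quotient_stack R[i] n (n - d) :=
  QuotientStack (quantum_act0 k) (quantum_actD k)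
    (fun t z => (quantum_atlas_act h k Delta I t z).2).

Section Exceptional.
Variables (h : 'M[R]_(d, n)) (k : 'M[R]_(n, n - d)).
Variables (Delta1 : set (set 'cV[R]_d)) (I1 : set 'I_n).
Variables (Delta2 : set (set 'cV[R]_d)) (I2 : set 'I_n).

(* Atlas of the common open substack.  The label of a ray of a common cone is
   virtual for neither fan. *)
Definition common_atlas : set 'cV[R[i]]_n :=
  quantum_atlas h (Delta1 `&` Delta2) (I1 `|` I2).

Definition exceptional_atlas : set 'cV[R[i]]_n :=
  quantum_atlas h Delta1 I1 `\` common_atlas.

Lemma exceptional_atlas_act t z :
  exceptional_atlas z -> exceptional_atlas (quantum_act k t z).
Proof.
move=> [Sz nz]; split; first exact/quantum_atlas_act.
by move=> /quantum_atlas_act.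
Qed.

(* exceptional locus of the combinatorial birational map from the stack of
   (Delta1, h, I1) to the stack of (Delta2, h, I2) *)
Definition exceptional_locus : substack (quantum_stack h k Delta1 I1) :=
  @Substack _ _ _ (quantum_stack h k Delta1 I1) exceptional_atlas
    (fun z => @proj1 _ _) exceptional_atlas_act.

End Exceptional.

End QuantumStacks.

(* Main.v *)
Require Import Defs.
From HB Require Import structures.
From mathcomp Require Import all_boot all_order all_algebra.
From mathcomp Require Import all_classical all_reals all_analysis.
From mathcomp Require Import complex.
From mathcomp Require Import ring lra.
Import Order.TTheory GRing.Theory Num.Theory numFieldNormedType.Exports.
Local Open Scope classical_set_scope.
Local Open Scope ring_scope.

(* The cones of the normal fan of P_b are the cones N_b(x), x in P_b, of linear
   forms minimised at x, and b |-> (support function of P_b) identifies the b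
   over Gamma_(Delta, J) with the functions of CSF(Delta).  Every argument then
   concerns the index sets of the constraints tight at points of P_b.

   Choose b0 giving (Delta, h, I) with no point of P_b0 on a virtual constraint.
   For small e the fan of P_(b0 + e a) refines Delta, so Gamma_(Delta, I) is
   contained in the corresponding secondary cone; by maximality of the chamber
   they agree, which forces P_b0 to be simple.  Conversely, near a simple
   polytope the fan does not change, and a secondary cone with an interior point
   of this kind is a chamber, because when a sum of concave functions is linear
   on a cone then so are the summands.

   The facet of Gamma_(Delta, I) is cut out by the relation between h(e_i) and
   the rays of the cone of Delta containing it.  Pushing the i-th constraint
   until it touches P_b0 gives a point push of the wall.  The fan on the relative
   interior of the wall is that of a Minkowski combination of P_push with another
   polytope whose support function is linear on the cones of Delta.  Pushing the
   constraint slightly further truncates the polytope, which performs the star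
   subdivision and keeps it simple.

   A point of the atlas of Delta' outside the common atlas must have z_i = 0,
   since removing h(e_i) from a cone of the star subdivision leaves a common
   cone; conversely the points with z_i = 0 as only zero coordinate are in the
   exceptional locus. *)

Set Implicit Arguments.
Unset Strict Implicit.
Unset Printing Implicit Defensive.

(** * Linear inequalities *)

Section Small.
Variable R : realType.

Lemma near0_affine_gt0 (p q : R) : 0 < p -> \forall e \near 0^'+, 0 < p + e * q.
Proof.
move=> p0; near=> e.
have e0 : 0 < e by near: e; exact: nbhs_right_gt.
have : e * (`|q| + 1) < p.
  rewrite -ltr_pdivlMr; last by rewrite ltr_wpDl.
  by near: e; apply: nbhs_right_lt; rewrite divr_gt0// ltr_wpDl.
have : e * - `|q| <= e * q by rewrite ler_pM2l// lerNl -normrN ler_norm.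
nra.
Unshelve. all: by end_near. Qed.

Lemma near0_forall (T : finType) (P : T -> R -> Prop) :
  (forall j, \forall e \near 0^'+, P j e) ->
  \forall e \near 0^'+, forall j, P j e.
Proof.
by move=> H; apply: filter_forall.
Qed.

Lemma near0_ex (P : R -> Prop) :
  (\forall e \near 0^'+, P e) -> exists2 e, 0 < e & P e.
Proof.
move=> H; near (0:R)^'+ => e; exists e; first by near: e; exact: nbhs_right_gt.
by near: e.
Unshelve. all: by end_near. Qed.

End Small.

Section Dot.
Variables (R : realType) (m : nat).
Implicit Types x y u v : 'cV[R]_m.

Lemma dotvC x y : dotv x y = dotv y x.
Proof. by rewrite /dotv; apply: eq_bigr => i _; rewrite mulrC. Qed.

Lemma dotvDl x y u : dotv (x + y) u = dotv x u + dotv y u.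
Proof. by rewrite /dotv -big_split; apply: eq_bigr => i _; rewrite mxE mulrDl. Qed.

Lemma dotvZl c x u : dotv (c *: x) u = c * dotv x u.
Proof. by rewrite /dotv mulr_sumr; apply: eq_bigr => i _; rewrite mxE mulrA. Qed.

Lemma dotvDr x y u : dotv u (x + y) = dotv u x + dotv u y.
Proof. by rewrite !(dotvC u) dotvDl. Qed.

Lemma dotvZr c x u : dotv u (c *: x) = c * dotv u x.
Proof. by rewrite !(dotvC u) dotvZl. Qed.

Lemma dotvNl x u : dotv (- x) u = - dotv x u.
Proof. by rewrite -scaleN1r dotvZl mulN1r. Qed.

Lemma dotvNr x u : dotv u (- x) = - dotv u x.
Proof. by rewrite !(dotvC u) dotvNl. Qed.

Lemma dotv0l u : dotv 0 u = 0.
Proof. by rewrite -(scale0r 0) dotvZl mul0r. Qed.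

Lemma dotv0r u : dotv u 0 = 0.
Proof. by rewrite dotvC dotv0l. Qed.

Lemma dotv_sumr (T : finType) (c : T -> R) (w : T -> 'cV[R]_m) u :
  dotv u (\sum_j c j *: w j) = \sum_j c j * dotv u (w j).
Proof.
rewrite (big_morph (dotv u) (fun x y => dotvDr x y u) (dotv0r u)).
by apply: eq_bigr => j _; rewrite dotvZr.
Qed.

Lemma dotv_ge0 v : 0 <= dotv v v.
Proof. by apply: sumr_ge0 => i _; rewrite -expr2 sqr_ge0. Qed.

Lemma dotv_eq0 v : (dotv v v == 0) = (v == 0).
Proof.
apply/idP/eqP => [|->]; last by rewrite dotv0l.
rewrite psumr_eq0 => [/allP H|i _]; last by rewrite -expr2 sqr_ge0.
apply/colP => i; have := H i (mem_index_enum i).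
by rewrite mulf_eq0 orbb mxE => /eqP.
Qed.

Lemma dotv_mx x y : dotv x y = (x^T *m y) 0 0.
Proof. by rewrite mxE; apply: eq_bigr => i _; rewrite mxE. Qed.

Lemma dotv_col_mx p (A : 'M[R]_(m, p)) x j : (A^T *m x) j 0 = dotv x (col j A).
Proof. by rewrite mxE dotvC; apply: eq_bigr => i _; rewrite !mxE. Qed.

End Dot.

Definition dotvE := (dotvDl, dotvDr, dotvNl, dotvNr, dotvZl, dotvZr, dotv0l, dotv0r).

Section Farkas.
Variables (R : realType) (m : nat).

(* Bartl's induction: eliminate the last vector by projecting the others along
   it onto the hyperplane orthogonal to a violating point x0. *)
Lemma farkas_ord (n : nat) (w : 'I_n -> 'cV[R]_m) (v : 'cV[R]_m) :
  (forall x, (forall j, 0 <= dotv x (w j)) -> 0 <= dotv x v) ->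
  exists2 c : 'I_n -> R, (forall j, 0 <= c j) & v = \sum_j c j *: w j.
Proof.
elim: n w v => [|n IH] w v H.
  exists (fun=> 0) => //; rewrite big_ord0; apply/eqP; rewrite -dotv_eq0.
  rewrite eq_le dotv_ge0 andbT -oppr_ge0 -dotvNl.
  by apply: H => -[].
pose w0 j := w (lift ord_max j); pose z := w ord_max.
have [|] := pselect (forall x, (forall j, 0 <= dotv x (w0 j)) -> 0 <= dotv x v).
  move=> /IH[c c0 ->].
  exists (fun j => if unlift ord_max j is Some k then c k else 0).
    by move=> j; case: unlift.
  rewrite (bigD1_ord ord_max)//= unlift_none scale0r add0r.
  by apply: eq_bigr => j _; rewrite liftK.
move=> /existsNP[x1 /not_implyP[x1w /negP]]; rewrite -ltNge => x1v.
have x1z : dotv x1 z < 0.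
  rewrite ltNge; apply/negP => x1z; move: x1v; rewrite ltNge => /negP; apply.
  by apply: H => j; case: (unliftP ord_max j) => [k|] ->; [exact: x1w|].
pose x0 := (- dotv x1 z)^-1 *: x1.
have t0 : 0 < (- dotv x1 z)^-1 by rewrite invr_gt0 oppr_gt0.
have x0z : dotv x0 z = -1.
  by rewrite /x0 dotvZl invrN mulNr mulVf// lt_eqF.
have x0w j : 0 <= dotv x0 (w0 j) by rewrite dotvZl mulr_ge0// ltW.
have x0v : dotv x0 v < 0 by rewrite dotvZl pmulr_rlt0.
clearbody x0.
have [|c c0 cE] := IH (fun j => w0 j + dotv x0 (w0 j) *: z) (v + dotv x0 v *: z).
  move=> x Hx; have -> : dotv x (v + dotv x0 v *: z) = dotv (x + dotv x z *: x0) v.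
    by rewrite !dotvE; ring.
  apply: H => j; case: (unliftP ord_max j) => [k|] ->.
    have := Hx k; rewrite !dotvE -/(w0 k); congr (_ <= _); ring.
  by rewrite !dotvE -/z x0z; lra.
exists (fun j => if unlift ord_max j is Some k then c k
                 else \sum_k c k * dotv x0 (w0 k) - dotv x0 v).
  move=> j; case: unlift => [k|]; first exact: c0.
  by rewrite subr_ge0 (le_trans (ltW x0v))// sumr_ge0// => k _; rewrite mulr_ge0.
rewrite (bigD1_ord ord_max)//= unlift_none -/z.
rewrite [X in _ + X](eq_bigr (fun k => c k *: w0 k)); last first.
  by move=> k _; rewrite liftK.
apply: (addIr (dotv x0 v *: z)); rewrite cE.
rewrite [LHS](eq_bigr (fun j => c j *: w0 j + (c j * dotv x0 (w0 j)) *: z)).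
  by rewrite big_split/= -scaler_suml scalerBl addrAC subrK addrC.
by move=> j _; rewrite scalerDr scalerA.
Qed.

Lemma farkas (n : nat) (w : 'I_n -> 'cV[R]_m) (J : set 'I_n) (v : 'cV[R]_m) :
  ~ cone_of w J v ->
  exists2 x, (forall j, J j -> 0 <= dotv x (w j)) & dotv x v < 0.
Proof.
apply: contra_notP => H.
have [|c c0 ->] := @farkas_ord n (fun j => if `[< J j >] then w j else 0) v.
  move=> x Hx; rewrite leNgt; apply/negP => xv; apply: H; exists x => // j Jj.
  by have := Hx j; rewrite asboolT.
exists (fun j => if `[< J j >] then c j else 0); split => [j|j nJ|].
- by case: ifP.
- by rewrite asboolF.
- by apply: eq_bigr => j _; case: ifP; rewrite ?scaler0 ?scale0r.
Qed.

End Farkas.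

(** Homogenisation: [b j] becomes a last coordinate of [w j]. If (0, -1) lies outside the cone of
    the lifted vectors, a separating (y, t) has t > 0 and y / t solves the system; otherwise the
    coefficients of (0, -1) are the certificate. *)
Lemma affine_farkas (R : realType) (m n : nat) (w : 'I_n -> 'cV[R]_m) (b : 'I_n -> R) :
  ~ (exists x, forall j, 0 <= dotv x (w j) + b j) ->
  exists c : 'I_n -> R, [/\ forall j, 0 <= c j, \sum_j c j *: w j = 0
    & \sum_j c j * b j < 0].
Proof.
move=> H; pose v j : 'cV[R]_(m + 1) := col_mx (w j) (const_mx (b j)).
have dotE x t (y : 'cV[R]_m) (s : R) :
    dotv (col_mx x (const_mx t) : 'cV_(m + 1)) (col_mx y (const_mx s)) = dotv x y + t * s.
  rewrite /dotv big_split_ord/= big_ord1; congr (_ + _).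
    by apply: eq_bigr => i _; rewrite !col_mxEu.
  by rewrite !col_mxEd !mxE.
have [[c [c0 _ cE]]|] :=
    pselect (cone_of v setT (col_mx 0 (const_mx (-1)))).
  exists c; split => //.
    have := congr1 usubmx cE; rewrite col_mxKu linear_sum/= => E.
    by rewrite [RHS]E; apply: eq_bigr => j _; rewrite linearZ/= col_mxKu.
  have := congr1 (fun A => dsubmx A 0 0) cE.
  rewrite col_mxKd mxE linear_sum summxE => E.
  suff -> : \sum_j c j * b j = -1 by rewrite ltrN10.
  by rewrite [RHS]E; apply: eq_bigr => j _; rewrite linearZ/= col_mxKd !mxE.
move=> /farkas[x]; rewrite -(vsubmxK x).
have -> : dsubmx x = const_mx (dsubmx x 0 0).
  by apply/colP => i; rewrite [RHS]mxE (ord1 i).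
move: (usubmx x) (dsubmx x 0 0) => y t xw.
rewrite dotE dotv0r add0r mulrN1 oppr_lt0 => t0.
exfalso; apply: H; exists (t^-1 *: y) => j.
have := xw j I; rewrite dotE => yw; rewrite dotvZl -(pmulr_rge0 _ t0).
by rewrite mulrDr mulrA divff ?mul1r// gt_eqF.
Qed.

(** * Polyhedra and their normal cones *)

Section MatrixNorm.
Variable R : realType.

Lemma ler_mx_norm_coord m p (x : 'M[R]_(m, p)) i j : `|x i j| <= `|x|.
Proof.
by rewrite [leRHS]/Num.Def.normr/= mx_normrE; apply/bigmax_geP; right; exists (i, j).
Qed.

Lemma mx_norm_le m p (x : 'M[R]_(m, p)) (M : R) :
  0 <= M -> (forall i j, `|x i j| <= M) -> `|x| <= M.
Proof.
move=> M0 H; rewrite [leLHS]/Num.Def.normr/= mx_normrE.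
by apply/bigmax_leP; split => // -[i j] _; exact: H.
Qed.

End MatrixNorm.

Section Polyhedra.
Variables (R : realType) (n d : nat) (h : 'M[R]_(d, n)).
Implicit Types (b a : 'cV[R]_n) (x y v w : 'cV[R]_d) (J : set 'I_n).

Definition slack b x (j : 'I_n) : R := dotv x (col j h) + b j 0.

Definition active b x : set 'I_n := [set j | slack b x j = 0].

(* For x in P_b this is the cone of the normal fan attached to the smallest
   face containing x, and every cone of the normal fan has this form. *)
Definition ncone b x : set 'cV[R]_d :=
  [set w | forall y, polyhedron h b y -> dotv x w <= dotv y w].

Definition spanning := forall w, cone_of (fun j => col j h) setT w.

(** A form in the relative interior of [ncone b x], used as a generic element of that cone. *)
Definition active_sum b x : 'cV[R]_d := \sum_(j | `[< active b x j >]) col j h.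

Lemma polyhedronE b x : polyhedron h b x <-> forall j, 0 <= slack b x j.
Proof. by split=> H j; have := H j; rewrite /slack -lerBlDr sub0r. Qed.

Lemma facetE b j x : facet h b j x <-> polyhedron h b x /\ active b x j.
Proof.
split=> -[Px /= Hx]; split=> //; rewrite /active/slack/=.
  by rewrite Hx addNr.
by apply/eqP; rewrite -addr_eq0; apply/eqP.
Qed.

Lemma slackD (s t : R) b a x v j :
  slack (s *: b + t *: a) (s *: x + t *: v) j = s * slack b x j + t * slack a v j.
Proof. by rewrite /slack !dotvE !mxE; ring. Qed.

Lemma slack_line b x v t j : slack b (x + t *: v) j = slack b x j + t * dotv v (col j h).
Proof. by rewrite /slack !dotvE; ring. Qed.

Lemma slack_conv b x y (t : R) j :
  slack b ((1 - t) *: x + t *: y) j = (1 - t) * slack b x j + t * slack b y j.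
Proof. by rewrite /slack !dotvE; ring. Qed.

Lemma polyhedron_conv b x y (t : R) : 0 <= t <= 1 ->
  polyhedron h b x -> polyhedron h b y -> polyhedron h b ((1 - t) *: x + t *: y).
Proof.
move=> /andP[t0 t1] /polyhedronE Px /polyhedronE Py; apply/polyhedronE => j.
by rewrite slack_conv addr_ge0// mulr_ge0// subr_ge0.
Qed.

Lemma polyhedron_mid b x y : polyhedron h b x -> polyhedron h b y ->
  polyhedron h b ((1 - 2^-1) *: x + 2^-1 *: y).
Proof. by move=> Px Py; apply: polyhedron_conv => //; apply/andP; split; lra. Qed.

Lemma conv_active b x y (t : R) : 0 < t < 1 ->
  polyhedron h b x -> polyhedron h b y ->
  active b ((1 - t) *: x + t *: y) = active b x `&` active b y.
Proof.
move=> /andP[t0 t1] /polyhedronE Px /polyhedronE Py.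
apply/seteqP; split => j; rewrite /active/= slack_conv; last first.
  by move=> [-> ->]; rewrite !mulr0 addr0.
have t1' : 0 < 1 - t by rewrite subr_gt0.
move=> /eqP; rewrite paddr_eq0 ?mulr_ge0 ?(ltW t0) ?(ltW t1')// => /andP[].
by rewrite !mulf_eq0 (gt_eqF t0) (gt_eqF t1')/= => /eqP ? /eqP ?.
Qed.

Lemma near0_slack_ge0 b x v J :
  (forall j, J j -> 0 <= slack b x j) ->
  (forall j, J j -> active b x j -> 0 <= dotv v (col j h)) ->
  \forall e \near 0^'+, forall j, J j -> 0 <= slack b (x + e *: v) j.
Proof.
move=> Jx Jv; apply: near0_forall => j.
have [Jj|nJ] := pselect (J j); last by apply: nearW.
have [xj|xj] := eqVneq (slack b x j) 0.
  apply: filterS (nbhs_right_gt 0) => e e0 _.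
  by rewrite slack_line xj add0r mulr_ge0// ?Jv// ltW.
have sx : 0 < slack b x j by rewrite lt_neqAle eq_sym xj Jx.
apply: filterS (near0_affine_gt0 (dotv v (col j h)) sx) => e /ltW + _.
by rewrite slack_line.
Qed.

(** For [w] outside the cone, Farkas gives a direction that keeps the tight constraints of [J] and
    decreases [w]; a small step along it stays in the polyhedron. A general [J] allows virtual
    generators to be discarded later. *)
Lemma ncone_cone_of b x J :
  (forall y, polyhedron h b y <-> forall j, J j -> 0 <= slack b y j) ->
  polyhedron h b x ->
  ncone b x = cone_of (fun j => col j h) (J `&` active b x).
Proof.
move=> PJ Px; apply/seteqP; split => w; last first.
  move=> [c [c0 cJ ->]] y Py; rewrite -subr_ge0 !dotv_sumr -sumrB.
  apply: sumr_ge0 => j _; rewrite -mulrBr.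
  have [[Jj xj]|/cJ ->] := pselect ((J `&` active b x) j); last by rewrite mul0r.
  rewrite mulr_ge0//; have := (polyhedronE b y).1 Py j.
  by move: xj; rewrite /active/slack/= => xj yj; lra.
apply: contraPP => /farkas[v vJ vw] xw.
have /PJ Px' := Px.
have [|e e0 He] := near0_ex (@near0_slack_ge0 b x v J Px' _).
  by move=> j Jj xj; apply: vJ; split.
have := xw _ ((PJ _).2 He); rewrite !dotvE lerDl.
by rewrite leNgt pmulr_rlt0// vw.
Qed.

Lemma nconeE b x : polyhedron h b x ->
  ncone b x = cone_of (fun j => col j h) (active b x).
Proof.
move=> Px; rewrite (@ncone_cone_of _ _ setT)// ?setTI// => y.
by rewrite polyhedronE; split => [H j _|H j]; exact: H.
Qed.

Lemma ncone_mono b x y : polyhedron h b x -> polyhedron h b y ->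
  active b x `<=` active b y -> ncone b x `<=` ncone b y.
Proof.
move=> Px Py xy; rewrite !nconeE// => w [c [c0 cx ->]].
by exists c; split => // j nj; apply: cx => /xy.
Qed.

Lemma active_ncone b x j : polyhedron h b x -> active b x j -> ncone b x (col j h).
Proof.
move=> Px xj y Py; have := (polyhedronE b y).1 Py j.
by move: xj; rewrite /active/slack/= => xj yj; lra.
Qed.

Lemma ncone_eq b x y w : polyhedron h b x -> polyhedron h b y ->
  ncone b x w -> ncone b y w -> dotv x w = dotv y w.
Proof. by move=> Px Py xw yw; apply/le_anti; rewrite xw// yw. Qed.

Lemma ncone_ge0 b x w : ncone b x w -> forall t, 0 <= t -> ncone b x (t *: w).
Proof. by move=> xw t t0 y Py; rewrite !dotvZr ler_wpM2l// xw. Qed.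

Lemma ncone_add b x v w : ncone b x v -> ncone b x w -> ncone b x (v + w).
Proof. by move=> xv xw y Py; rewrite !dotvDr lerD ?xv ?xw. Qed.

Lemma ncone_sum b x (T : finType) (P : pred T) (w : T -> 'cV[R]_d) :
  (forall j, P j -> ncone b x (w j)) -> ncone b x (\sum_(j | P j) w j).
Proof.
move=> H; elim/big_ind: _ => //; last exact: ncone_add.
by move=> y Py; rewrite !dotv0r.
Qed.

Lemma active_sum_ncone b x : polyhedron h b x -> ncone b x (active_sum b x).
Proof. by move=> Px; apply: ncone_sum => j /asboolP; exact: active_ncone. Qed.

Lemma dotv_active_sum b x y :
  dotv y (active_sum b x) =
  \sum_(j | `[< active b x j >]) slack b y j - \sum_(j | `[< active b x j >]) b j 0.
Proof.
rewrite /active_sum (big_morph _ (fun u v => dotvDr u v y) (dotv0r y)) -sumrB.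
by apply: eq_bigr => j _; rewrite /slack addrK.
Qed.

(** The form [active_sum b x] is, up to a constant, the sum of the slacks of the constraints tight
    at [x]. This sum is 0 at [x], hence at the minimiser [y], where its nonnegative terms must
    vanish. *)
Lemma active_sum_min b x y : polyhedron h b x -> polyhedron h b y ->
  ncone b y (active_sum b x) -> active b x `<=` active b y.
Proof.
move=> Px Py yx j xj; have := ncone_eq Px Py (active_sum_ncone Px) yx.
rewrite !dotv_active_sum big1 ?sub0r => [/esym/(canRL (subrK _))|]; last first.
  by move=> l /asboolP.
rewrite addNr => /eqP; rewrite psumr_eq0 => [/allP/(_ j (mem_index_enum j))|].
  by rewrite asboolT//= => /eqP.
by move=> l _; apply: (polyhedronE _ _).1.
Qed.

(* Otherwise the midpoint of x and y would have fewer active indices. *)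
Lemma exists_min_active b (S : set 'cV[R]_d) : S `<=` polyhedron h b ->
  (forall x y, S x -> S y -> S ((1 - 2^-1) *: x + 2^-1 *: y)) -> S !=set0 ->
  exists2 x, S x & forall y, S y -> active b x `<=` active b y.
Proof.
move=> SP Sc [x0 Sx0].
pose N x := #|[set j | `[< active b x j >]]%SET|.
have [m] := ubnP (N x0); elim: m x0 Sx0 => // m IH x Sx xm.
have [|/existsNP[y /not_implyP[Sy /subsetP/existsNP[j]]]] :=
    pselect (forall y, S y -> active b x `<=` active b y); first by exists x.
rewrite !inE => /not_implyP[xj yj]; apply: IH (Sc _ _ Sx Sy) _.
rewrite -ltnS; apply: leq_trans xm; rewrite ltnS; apply: proper_card.
have half : 0 < (2^-1 : R) < 1 by apply/andP; split; lra.
apply/properP; rewrite (conv_active half (SP _ Sx) (SP _ Sy)).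
split; last first.
  exists j; rewrite inE; first exact/asboolP.
  by apply/negP => /asboolP[].
by apply/fintype.subsetP => l; rewrite !inE => -[].
Qed.

(** If the cone were proper, Farkas would give a nonzero direction of recession of the
    polyhedron. *)
Lemma bounded_spanning b x : polyhedron h b x -> bounded_set (polyhedron h b) ->
  spanning.
Proof.
move=> Px Pb w; apply: contrapT => /farkas[v vh vw].
have [M [Mr HM]] := Pb.
have {}HM : forall y, polyhedron h b y -> `|y| <= M + 1.
  by apply: HM; rewrite ltrDl.
have Hv t : 0 <= t -> polyhedron h b (x + t *: v).
  move=> t0; apply/polyhedronE => j; rewrite slack_line addr_ge0//.
    exact: (polyhedronE _ _).1.
  by rewrite mulr_ge0// vh.
suff v0 : v = 0 by move: vw; rewrite v0 dotv0l ltxx.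
apply/colP => i; rewrite [RHS]mxE; apply/eqP; apply: contrapT => /negP vi.
have vi0 : 0 < `|v i 0| by rewrite normr_gt0.
have M0 : 0 <= M + 1 by rewrite (le_trans _ (HM x Px)).
pose t := (M + 2 + `|x i 0|) / `|v i 0|.
have t0 : 0 <= t by rewrite divr_ge0// addr_ge0//; lra.
have := le_trans (ler_mx_norm_coord _ i 0) (HM _ (Hv t t0)).
rewrite !mxE => H; have : `|t * v i 0| <= M + 1 + `|x i 0|.
  rewrite -(addrK (x i 0) (t * v i 0)) (le_trans (ler_normB _ _))// lerD2r.
  by rewrite addrC.
by rewrite normrM (ger0_norm t0) divfK ?gt_eqF//; lra.
Qed.

(** A nonnegative combination of the [col j h] is bounded below on the polyhedron; this is applied
    to the coordinate forms and their opposites. *)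
Lemma spanning_bounded b : spanning -> bounded_set (polyhedron h b).
Proof.
move=> sp; have low w : exists M, forall x, polyhedron h b x -> M <= dotv x w.
  have [c [c0 _ ->]] := sp w; exists (- \sum_j c j * b j 0) => x /polyhedronE Px.
  rewrite dotv_sumr -subr_ge0 opprK -big_split/=.
  by apply: sumr_ge0 => j _; rewrite -mulrDr mulr_ge0// Px.
pose e i : 'cV[R]_d := delta_mx i 0.
have dote x i : dotv x (e i) = x i 0.
  rewrite /dotv (bigD1 i)//= big1 => [|l li]; rewrite !mxE ?eqxx ?mulr1 ?addr0//.
  by rewrite (negbTE li) mulr0.
have bd i : exists M, forall x, polyhedron h b x -> `|x i 0| <= M.
  have [[M HM] [M' HM']] := (low (e i), low (- e i)).
  exists (`|M| + `|M'|) => x Px; have := HM x Px; have := HM' x Px.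
  rewrite dotvNr !dote => H1 H2.
  rewrite ler_norml; have := ler_norm (- M); have := ler_norm (- M').
  rewrite !normrN => N1 N2; have := normr_ge0 M; have := normr_ge0 M'.
  by move=> ? ?; apply/andP; split; lra.
have [M HM] := choice bd.
exists (\sum_i `|M i|); split; first by rewrite num_real.
move=> y My x Px; apply: (le_trans _ (ltW My)); apply: mx_norm_le.
  by apply: sumr_ge0.
move=> i j; rewrite (ord1 j); apply: (le_trans (HM i x Px)).
apply: (le_trans (ler_norm _)); rewrite (bigD1 i)//= lerDl.
by apply: sumr_ge0.
Qed.

(* The minimum of a linear form is attained: if it were not, Farkas' lemma
   applied to P_b and [dotv x w <= r], r the infimum, would give a lower bound
   larger than r. *)
Lemma ncone_complete b w : spanning -> polyhedron h b !=set0 ->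
  exists2 x, polyhedron h b x & ncone b x w.
Proof.
move=> sp [x0 Px0]; pose E := [set dotv x w | x in polyhedron h b]; pose r := inf E.
have lE : has_lbound E.
  have [c [c0 _ wE]] := sp w; exists (- \sum_j c j * b j 0) => _ [x /polyhedronE Px <-].
  rewrite wE dotv_sumr -subr_ge0 opprK -big_split/=.
  by apply: sumr_ge0 => j _; rewrite -mulrDr mulr_ge0// Px.
have rP x : polyhedron h b x -> r <= dotv x w by move=> Px; apply: ge_inf => //; exists x.
pose w' (j : 'I_n.+1) := oapp (fun l => col l h) (- w) (unlift ord_max j).
pose b' (j : 'I_n.+1) := oapp (fun l => b l 0) r (unlift ord_max j).
have [[x Hx]|/affine_farkas[c [c0 cw cb]]] :=
    pselect (exists x, forall j, 0 <= dotv x (w' j) + b' j).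
  have Px : polyhedron h b x.
    by apply/polyhedronE => j; have := Hx (lift ord_max j); rewrite /w' /b' liftK.
  exists x => // y Py; apply: le_trans (rP y Py).
  by have := Hx ord_max; rewrite /w' /b' unlift_none/= dotvNr addrC subr_ge0.
exfalso; pose c1 j := c (lift ord_max j); pose m := c ord_max.
have {}cw : m *: w = \sum_j c1 j *: col j h.
  apply/eqP; rewrite -subr_eq0 -oppr_eq0 opprB addrC -scalerN; apply/eqP.
  rewrite -[RHS]cw (bigD1_ord ord_max)//= /w' unlift_none; congr (_ + _).
  by apply: eq_bigr => j _; rewrite liftK.
have {}cb : m * r + \sum_j c1 j * b j 0 < 0.
  apply: le_lt_trans cb; rewrite (bigD1_ord ord_max)//= /b' unlift_none lerD2l.
  by apply: ler_sum => j _; rewrite liftK.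
have mP x : polyhedron h b x -> m * r < m * dotv x w.
  move=> /polyhedronE Px; rewrite -dotvZr cw dotv_sumr.
  suff : 0 <= \sum_j c1 j * dotv x (col j h) + \sum_j c1 j * b j 0 by lra.
  rewrite -big_split/=; apply: sumr_ge0 => j _.
  by rewrite -mulrDr mulr_ge0//; [exact: c0|exact: Px].
have m0 : 0 < m.
  rewrite lt_neqAle c0 andbT eq_sym; apply/eqP => m0.
  by have := mP _ Px0; rewrite m0 !mul0r ltxx.
have : - (\sum_j c1 j * b j 0) / m <= r.
  apply: lb_le_inf; first by exists (dotv x0 w), x0.
  move=> _ [x /polyhedronE Px <-]; rewrite ler_pdivrMr// mulrC -dotvZr cw dotv_sumr.
  rewrite -subr_ge0 opprK -big_split/=; apply: sumr_ge0 => j _.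
  by rewrite -mulrDr mulr_ge0//; [exact: c0|exact: Px].
by rewrite ler_pdivrMr// leNgt => /negP; apply; lra.
Qed.

End Polyhedra.

(** * Independent directions and dimension *)

Section Dimension.
Variables (R : realType) (m : nat).
Implicit Types (S : set 'cV[R]_m) (x : 'cV[R]_m).

Lemma dim_ge_leq S q : dim_ge S q -> (q <= m)%N.
Proof. by move=> [x _ [A rA _]]; rewrite -rA rank_leq_row. Qed.

Lemma dim_ge_near0 S x p (B : 'M[R]_(m, p)) : S x -> \rank B = p ->
  (forall j, \forall e \near 0^'+, S (x + e *: col j B)) -> dim_ge S p.
Proof.
move=> Sx rB /near0_forall/near0_ex[e e0 He]; exists x => //.
exists (e *: B) => [|j]; first by rewrite mxrank_scale_nz// gt_eqF.
by rewrite linearZ; exact: He.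
Qed.

Lemma rank_cV (v : 'cV[R]_m) : \rank v = (v != 0).
Proof. by rewrite -mxrank_tr rank_rV trmx_eq0. Qed.

Lemma hyperplane_basis (v : 'cV[R]_m) : v != 0 ->
  exists2 B : 'M[R]_(m, m.-1), \rank B = m.-1 & forall j, dotv (col j B) v = 0.
Proof.
move=> v0; have rk : \rank (kermx v) = m.-1.
  by rewrite mxrank_ker rank_cV v0 subn1.
rewrite -rk; exists (row_base (kermx v))^T.
  by rewrite mxrank_tr eq_row_base.
move=> j; rewrite dotv_mx tr_col trmxK -row_mul.
have /eqP -> : row_base (kermx v) *m v == 0.
  by rewrite -sub_kermx eq_row_base.
by rewrite row0 mxE.
Qed.

End Dimension.

(** * Full-dimensional polytopes, their facets and their fans *)

Section FullPolyhedra.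
Variables (R : realType) (n d : nat) (h : 'M[R]_(d, n)).
Hypothesis hgeom : geometric_map h.
Implicit Types (b a : 'cV[R]_n) (x y v w : 'cV[R]_d) (J : set 'I_n).

Definition interior_point b x := forall j, 0 < slack h b x j.

Lemma interior_polyhedron b x : interior_point b x -> polyhedron h b x.
Proof. by move=> ix; apply/polyhedronE => j; rewrite ltW. Qed.

Lemma interior_active b x : interior_point b x -> active h b x = set0.
Proof.
by move=> ix; apply/seteqP; split => // j xj; have := ix j; rewrite xj ltxx.
Qed.

Lemma active0_interior b x : polyhedron h b x -> active h b x = set0 ->
  interior_point b x.
Proof.
move=> /polyhedronE Px x0 j; rewrite lt_neqAle Px andbT eq_sym; apply/eqP => xj.
by have : set0 j by rewrite -x0.
Qed.

Lemma col_inj i j : (exists c, col j h = c *: col i h) -> i = j.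
Proof.
move=> H; apply: contrapT => /eqP ij.
by have [_ /(_ _ _ ij)] := hgeom; apply.
Qed.

Lemma ray_inj i j : ray (col i h) (col j h) -> i = j.
Proof. by move=> [c _ E]; apply: col_inj; exists c. Qed.

(** A constraint tight at a point with the fewest tight constraints is tight on the whole polytope;
    its normal is then orthogonal to d independent directions, hence 0. *)
Lemma full_polytope_interior b : full_polytope h b -> exists x, interior_point b x.
Proof.
move=> [_ [[x0 Px0 [A rA PA]] _]].
have [x Px xmin] := exists_min_active (@subset_refl _ (polyhedron h b))
  (@polyhedron_mid _ _ _ h b) (ex_intro _ x0 Px0).
exists x; apply: active0_interior => //; apply/seteqP; split => // j /xmin xj.
have Aj : A^T *m col j h = 0.
  apply/colP => l; rewrite [RHS]mxE dotv_col_mx.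
  have := xj _ (PA l); have := xj _ Px0.
  by rewrite /active/slack/= dotvDl (dotvC (col j h)) => ? ?; lra.
have [/(_ j)/eqP + _] := hgeom; apply.
have Au : A^T \in unitmx by rewrite unitmx_tr -row_full_unit /row_full rA.
by rewrite -(mulKmx Au (col j h)) Aj mulmx0.
Qed.

Lemma interior_full_polytope b x : spanning h -> interior_point b x ->
  full_polytope h b.
Proof.
move=> sp ix; split; first exact: spanning_bounded.
split => [|q]; last exact: dim_ge_leq.
apply: (@dim_ge_near0 _ _ _ x _ 1%:M); rewrite ?mxrank1//.
  exact: interior_polyhedron.
move=> j; have xv l : setT l -> active h b x l -> 0 <= dotv (col j 1%:M) (col l h).
  by move=> _ xl; have := ix l; rewrite xl ltxx.
apply: filterS (near0_slack_ge0 (fun l _ => ltW (ix l)) xv) => e He.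
by apply/polyhedronE => l; exact: He.
Qed.

Lemma full_polytope_spanning b : full_polytope h b -> spanning h.
Proof.
move=> fb; have [x /interior_polyhedron Px] := full_polytope_interior fb.
by case: fb => /(bounded_spanning Px).
Qed.

(** Near [x] in the hyperplane of [j] the other constraints of [J] remain satisfied, so the facet
    contains d - 1 independent directions. A partial list [J] serves the removal of constraints one
    at a time. *)
Lemma point_nonvirtual b J x j :
  (forall y, (forall l, J l -> 0 <= slack h b y l) -> polyhedron h b y) ->
  active h b x j -> (forall l, J l -> l != j -> 0 < slack h b x l) ->
  ~ virtual_facets h b j.
Proof.
move=> PJ xj xJ; apply.
have [B rB Bj] := hyperplane_basis (proj1 hgeom j).
have Jx l : J l -> 0 <= slack h b x l.
  by have [->|lj] := eqVneq l j; [rewrite xj|move=> /xJ/(_ lj)/ltW].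
apply: (@dim_ge_near0 _ _ _ x _ B) => //.
  by apply/facetE; split => //; exact: PJ.
move=> l; have xv l' : J l' -> active h b x l' -> 0 <= dotv (col l B) (col l' h).
  move=> Jl' xl'; have [->|/(xJ _ Jl')] := eqVneq l' j; first by rewrite Bj.
  by rewrite xl' ltxx.
apply: filterS (near0_slack_ge0 Jx xv) => e He; apply/facetE; split; first exact: PJ.
by rewrite /active/= slack_line Bj mulr0 addr0.
Qed.

(** At a point of the facet with the fewest tight constraints, any tight [l] is tight on the whole
    facet. As the facet spans d - 1 directions, [col l h] is proportional to [col j h], so [l] is
    [j]. *)
Lemma nonvirtual_point b j : ~ virtual_facets h b j ->
  exists2 x, polyhedron h b x & active h b x = [set j].
Proof.
move=> /contrapT[x0 Fx0 [A rA FA]].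
have mid x y : facet h b j x -> facet h b j y ->
    facet h b j ((1 - 2^-1) *: x + 2^-1 *: y).
  have half : 0 < (2^-1 : R) < 1 by apply/andP; split; lra.
  move=> /facetE[Px xj] /facetE[Py yj]; apply/facetE; split.
    exact: polyhedron_mid.
  by rewrite conv_active.
have [x /facetE[Px xj] xmin] := exists_min_active (@subIsetl _ _ _) mid
  (ex_intro _ x0 Fx0).
exists x => //; apply/seteqP; split => [l /xmin xl|l ->//].
apply/esym; apply: col_inj.
have ker i : (forall y, facet h b j y -> active h b y i) -> ((col i h)^T <= kermx A)%MS.
  move=> Hi; rewrite sub_kermx -trmx_eq0 trmx_mul trmxK; apply/eqP/colP => q.
  rewrite [RHS]mxE dotv_col_mx; have := Hi _ (FA q); have := Hi _ Fx0.
  by rewrite /active/slack/= dotvDl (dotvC (col i h)) => ? ?; lra.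
have hj : (col j h)^T != 0 by rewrite trmx_eq0; have [] := hgeom.
have kj : ((col j h)^T <= kermx A)%MS by apply: ker => y /facetE[].
have d0 : (0 < d)%N.
  case: (d) (col j h) hj => // v; rewrite trmx_eq0 => /eqP[].
  by apply/colP => -[].
have kl : ((col l h)^T <= (col j h)^T)%MS.
  apply: submx_trans (ker l xl) _; rewrite -(mxrank_leqif_sup kj).
  by rewrite mxrank_ker rA rank_rV hj -subn1 subKn.
have /sub_rVP[c E] := kl; exists c.
by apply: trmx_inj; rewrite E linearZ.
Qed.

Lemma active1_nonvirtual b x j : polyhedron h b x -> active h b x = [set j] ->
  ~ virtual_facets h b j.
Proof.
move=> Px xE; apply: (@point_nonvirtual b setT x) => [y H|| l _ lj].
- by apply/polyhedronE => l; exact: H.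
- by rewrite xE.
- rewrite lt_neqAle ((polyhedronE _ _ _).1 Px) andbT eq_sym; apply/eqP => xl.
  have : [set j] l by rewrite -xE.
  by move=> /= E; rewrite E eqxx in lj.
Qed.

(* Constraints are removed one at a time: a virtual constraint violated at y
   would be tight at a point of the segment from an interior point to y where
   the remaining constraints are strict. *)
Lemma irredundant b x0 : interior_point b x0 ->
  forall y, polyhedron h b y <->
    forall j, (~` virtual_facets h b) j -> 0 <= slack h b y j.
Proof.
move=> ix0 y; split => [/polyhedronE Py j _|]; first exact: Py.
suff H (s : seq 'I_n) : (forall j, j \in s -> virtual_facets h b j) ->
    forall y, (forall j, j \notin s -> 0 <= slack h b y j) -> polyhedron h b y.
  move=> Hy; apply: (H [seq j <- enum 'I_n | `[< virtual_facets h b j >]]).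
    by move=> j; rewrite mem_filter => /andP[/asboolP].
  move=> j; rewrite mem_filter mem_enum andbT => /asboolP; exact: Hy.
elim: s => [|l s IH] vs {}y Hy; first by apply/polyhedronE => j; exact: Hy.
have {}IH := IH (fun j js => vs j (mem_behead (s := l :: s) js)).
have [yl|yl] := leP 0 (slack h b y l).
  apply: IH => j js; have [->//|jl] := eqVneq j l.
  by apply: Hy; rewrite inE (negbTE jl).
exfalso; pose p := slack h b x0 l; pose q := slack h b y l.
have p0 : 0 < p := ix0 l.
(* The slack of [l], positive at [x0] and negative at [y], vanishes at parameter [t] of the
   segment. *)
pose t := p / (p - q); have pq : 0 < p - q by rewrite subr_gt0 (lt_trans yl).
have t0 : 0 < t by rewrite divr_gt0.
have t1 : t < 1 by rewrite ltr_pdivrMr// mul1r ltrBrDl gtrDr.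
apply: (@point_nonvirtual b [set j | j \notin s] ((1 - t) *: x0 + t *: y) l).
- by move=> z Hz; apply: IH.
- rewrite /active/= slack_conv -/p -/q /t; field.
  by rewrite gt_eqF.
- move=> j js jl; rewrite slack_conv ltr_wpDr//.
    by rewrite mulr_ge0 ?(ltW t0)// Hy// inE (negbTE jl).
  by rewrite mulr_gt0 ?subr_gt0.
- by apply: vs; rewrite inE eqxx.
Qed.

(** A face is represented by a point of it with the fewest tight constraints; conversely [x]
    determines the face minimising [active_sum h b x]. Irredundancy reconciles the two sets of
    generators. *)
Lemma normal_fanE b x0 : interior_point b x0 ->
  normal_fan h b = [set s | exists2 x, polyhedron h b x & s = ncone h b x].
Proof.
move=> /irredundant PJ; apply/seteqP; split => s.
  move=> [Q [Q0 [u QE]] ->].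
  have [|x y|//|x Qx xmin] := @exists_min_active _ _ _ h b Q.
  - by rewrite QE => x [].
  - rewrite QE => -[Px xu] [Py yu]; split.
      exact: polyhedron_mid.
    move=> z Pz; have := xu z Pz; have := yu z Pz; rewrite !dotvE; lra.
  have Px : polyhedron h b x by move: Qx; rewrite QE => -[].
  exists x => //; rewrite (ncone_cone_of PJ Px); congr cone_of; congr (_ `&` _).
  apply/seteqP; split => i; first by move=> /(_ _ Qx)/facetE[].
  move=> xi y Qy; apply/facetE; split; first by move: Qy; rewrite QE => -[].
  exact: xmin.
move=> [x Px ->]; pose Q := [set y | polyhedron h b y /\ ncone h b y (active_sum h b x)].
have Qx : Q x by split => //; exact: active_sum_ncone.
exists Q; first by split; [exists x|exists (active_sum h b x)].
rewrite (ncone_cone_of PJ Px) /normal_cone; congr cone_of; congr (_ `&` _).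
apply/seteqP; split => i; last by move=> /(_ _ Qx)/facetE[].
by move=> xi y [Py yx]; apply/facetE; split => //; exact: active_sum_min xi.
Qed.

(** On [ncone h b y] the form [x - y] is nonnegative and vanishes exactly at the [w] that are also
    minimised at [x]. *)
Lemma subcone_face b x y : polyhedron h b x -> polyhedron h b y ->
  ncone h b x `<=` ncone h b y -> cone_face (ncone h b y) (ncone h b x).
Proof.
move=> Px Py xy; exists (x - y) => [w yw|].
  by rewrite dotvC !dotvE subr_ge0 yw.
apply/seteqP; split => w.
  move=> xw; have yw := xy _ xw; split => //.
  by rewrite dotvC !dotvE (ncone_eq Px Py xw yw) subrr.
move=> [yw] /eqP; rewrite dotvC !dotvE subr_eq0 => /eqP E z Pz.
by rewrite E yw.
Qed.

(** A small step from [x] along the form [u] exposing the face keeps tight exactly the constraints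
    with normal orthogonal to [u], which generate the face. *)
Lemma face_ncone b x F : polyhedron h b x -> cone_face (ncone h b x) F ->
  exists2 y, polyhedron h b y & F = ncone h b y.
Proof.
move=> Px [u uge FE].
have [e e0 He] : exists2 e, 0 < e &
    (forall j, 0 <= slack h b (x + e *: u) j /\
      (~ active h b x j -> 0 < slack h b (x + e *: u) j)).
  apply: near0_ex; apply: near0_forall => j.
  have [xj|xj] := eqVneq (slack h b x j) 0.
    apply: filterS (nbhs_right_gt 0) => e e0; split => //.
    rewrite slack_line xj add0r mulr_ge0// ?(ltW e0)// dotvC.
    by apply: uge; apply: active_ncone.
  have sx : 0 < slack h b x j.
    by rewrite lt_neqAle eq_sym xj; exact: (polyhedronE _ _ _).1.
  apply: filterS (near0_affine_gt0 (dotv u (col j h)) sx) => e.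
  by rewrite slack_line => ?; split => //; rewrite ltW.
have Py : polyhedron h b (x + e *: u).
  by apply/polyhedronE => j; have [] := He j.
have yE j : active h b (x + e *: u) j <-> active h b x j /\ dotv u (col j h) = 0.
  split => [yj|[xj uj]]; last first.
    by rewrite /active/= slack_line xj uj mulr0 addr0.
  have xj : active h b x j.
    by apply: contrapT => /(proj2 (He j)); rewrite yj ltxx.
  split => //; move: yj; rewrite /active/= slack_line xj add0r => /eqP.
  by rewrite mulf_eq0 gt_eqF//= => /eqP.
exists (x + e *: u) => //; rewrite FE !nconeE//; apply/seteqP; split => w.
  move=> [[c [c0 cx ->]]] /eqP; rewrite dotvC dotv_sumr psumr_eq0; last first.
    move=> j _; have [xj|/cx ->] := pselect (active h b x j); last by rewrite mul0r.
    by rewrite mulr_ge0// dotvC; apply: uge; apply: active_ncone.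
  move=> /allP cu; exists c; split => // j nyj.
  have [xj|/cx//] := pselect (active h b x j).
  have := cu j (mem_index_enum j); rewrite mulf_eq0 => /orP[/eqP//|/eqP uj].
  by exfalso; apply: nyj; apply/yE.
move=> [c [c0 cy ->]]; split.
  by exists c; split => // j xj; apply: cy => /yE[].
rewrite dotvC dotv_sumr big1// => j _.
by have [/yE[_ ->]|/cy ->] := pselect (active h b (x + e *: u) j); rewrite ?mulr0 ?mul0r.
Qed.

(** This description by normal cones serves to compare the virtual sets of polytopes with the same
    fan. *)
Lemma nonvirtual_ray b j : ~ virtual_facets h b j <->
  exists x, [/\ polyhedron h b x, active h b x j & ncone h b x = ray (col j h)].
Proof.
split => [/nonvirtual_point[x Px xE]|[x [Px xj xE]]].
  exists x; split; rewrite ?xE// nconeE// xE; apply/seteqP; split => w.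
    move=> [c [c0 cj ->]]; exists (c j) => //.
    rewrite (bigD1 j)//= big1 ?addr0// => l lj.
    by rewrite cj ?scale0r// => /eqP; rewrite (negbTE lj).
  move=> [c c0 ->]; exists (fun l => if l == j then c else 0); split => [l|l|].
  - by case: ifP.
  - by move=> /eqP/negbTE ->.
  - rewrite (bigD1 j)//= eqxx big1 ?addr0// => l /negbTE ->.
    by rewrite scale0r.
apply: (active1_nonvirtual Px); apply/seteqP; split => [l xl|l ->//].
by apply/esym/ray_inj; rewrite -xE; exact: active_ncone.
Qed.

Lemma fan_complete b x0 w : spanning h -> interior_point b x0 ->
  exists2 x, polyhedron h b x & ncone h b x w.
Proof.
move=> sp /interior_polyhedron Px; apply: ncone_complete => //.
by exists x0.
Qed.

Lemma fan_support_setT b x0 : spanning h -> interior_point b x0 ->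
  fan_support (normal_fan h b) = setT.
Proof.
move=> sp ix; apply/seteqP; split => // w _; rewrite (normal_fanE ix).
by have [x Px xw] := fan_complete w sp ix; exists (ncone h b x) => //; exists x.
Qed.

(** A generic element of a cone of the second fan lies in a cone of the first, of which the given
    cone is then a face; a normal fan contains the faces of its cones. *)
Lemma normal_fan_sub_eq a b x0 y0 : spanning h -> interior_point a x0 ->
  interior_point b y0 -> normal_fan h a `<=` normal_fan h b ->
  normal_fan h a = normal_fan h b.
Proof.
move=> sp ix iy; rewrite (normal_fanE ix) (normal_fanE iy) => ab.
apply/seteqP; split => // _ [z Pz ->].
have [x Px xw] := fan_complete (active_sum h b z) sp ix.
have [z' Pz' xE] := ab _ (ex_intro2 _ _ x Px erefl).
have zz' : ncone h b z `<=` ncone h b z'.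
  by apply: ncone_mono => //; apply: active_sum_min; rewrite -?xE.
have /(face_ncone Px)[y Py zE] : cone_face (ncone h a x) (ncone h b z).
  by rewrite xE; exact: subcone_face.
by exists y.
Qed.

(** A cone is generated by the [col j h] it contains, so a strict inclusion raises their number,
    which is at most [n]. The set [D] may be the common part of two fans. *)
Lemma exists_maximal_cone b x0 (D : set (set 'cV[R]_d)) s :
  interior_point b x0 -> D `<=` normal_fan h b -> D s ->
  exists2 m, maximal_cone D m & s `<=` m.
Proof.
move=> ix; rewrite (normal_fanE ix) => DF.
pose N (t : set 'cV[R]_d) := #|[set j | `[< t (col j h) >]]%SET|.
have [m] := ubnP (n - N s); elim: m s => // m IH s sm Ds.
have [smax|/existsNP[t]] := pselect (forall t, D t -> s `<=` t -> t = s).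
  by exists s.
move=> /not_implyP[Dt /not_implyP[st ts]].
suff Nst : (N s < N t)%N.
  have [||r mr tr] := IH t => //; last by exists r => //; exact: subset_trans tr.
  rewrite -ltnS; apply: leq_trans sm; rewrite ltnS ltn_sub2l//.
  by apply: leq_trans Nst _; rewrite -[X in (_ <= X)%N](card_ord n) max_card.
apply: proper_card; apply/properP; split.
  by apply/fintype.subsetP => j; rewrite !inE; exact: st.
apply: contrapT => /forall2NP H; apply: ts; apply/seteqP; split => //.
have [[x Px tE] [y Py sE]] := (DF _ Dt, DF _ Ds).
rewrite {1}tE nconeE// => w [c [c0 cx ->]]; rewrite sE.
apply: ncone_sum => j _.
have [xj|/cx ->] := pselect (active h b x j); last first.
  by rewrite scale0r => z _; rewrite !dotv0r.
apply: ncone_ge0 => //; rewrite -sE.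
have [|] := H j; rewrite inE; last by move=> /negP; rewrite negbK => /asboolP.
by move=> []; apply/asboolP; rewrite tE; exact: active_ncone.
Qed.

End FullPolyhedra.

(** * Support functions and secondary cones *)

Section SupportFunctions.
Variables (R : realType) (n d : nat) (h : 'M[R]_(d, n)).
Hypothesis hgeom : geometric_map h.
Hypothesis sp : spanning h.
Implicit Types (b a c : 'cV[R]_n) (x y z v w : 'cV[R]_d) (J : set 'I_n).
Implicit Types (phi : 'cV[R]_d -> R) (Delta : set (set 'cV[R]_d)).

(* the set of b whose image under k^T is [Gamma h k Delta J] *)
Definition Gamma_lift Delta J b : Prop :=
  exists2 phi, CSF Delta phi &
    (forall j, ~ J j -> phi (col j h) = - b j 0) /\
    (forall i, J i -> - b i 0 <= phi (col i h)).

(** The support function, with the convention of a minimum over the polyhedron. [xget] picks a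
    minimiser, or 0 if there is none. *)
Definition supp b w : R :=
  dotv (xget 0 [set x | polyhedron h b x /\ ncone h b x w]) w.

Lemma suppE b x w : polyhedron h b x -> ncone h b x w -> supp b w = dotv x w.
Proof.
move=> Px xw; rewrite /supp; case: xgetP => [y _ [Py yw]|/(_ x)[]//].
exact: ncone_eq yw xw.
Qed.

Lemma supp_le b x w : polyhedron h b x -> supp b w <= dotv x w.
Proof.
move=> Px; have [|y Py yw] := @ncone_complete _ _ _ h b w sp; first by exists x.
by rewrite (suppE Py yw) yw.
Qed.

Lemma ncone_supp b x w : polyhedron h b x -> dotv x w = supp b w -> ncone h b x w.
Proof. by move=> Px E y Py; rewrite E supp_le. Qed.

Lemma supp_superadditive b v w : polyhedron h b !=set0 ->
  supp b v + supp b w <= supp b (v + w).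
Proof.
move=> Pb; have [x Px xw] := ncone_complete (v + w) sp Pb.
by rewrite (suppE Px xw) dotvDr lerD// supp_le.
Qed.

Lemma supp_col_ge b j : polyhedron h b !=set0 -> - b j 0 <= supp b (col j h).
Proof.
move=> Pb; have [x Px xw] := ncone_complete (col j h) sp Pb.
by rewrite (suppE Px xw); exact: Px.
Qed.

Lemma supp_col_active b x j : polyhedron h b x -> active h b x j ->
  supp b (col j h) = - b j 0.
Proof.
move=> Px xj; rewrite (suppE Px (active_ncone Px xj)).
by move: xj; rewrite /active/slack/= => xj; lra.
Qed.

Lemma supp_CSF b x0 : interior_point h b x0 -> CSF (normal_fan h b) (supp b).
Proof.
move=> ix; split => [s|x y _ _ _]; last first.
  by apply: supp_superadditive; exists x0; exact: interior_polyhedron.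
rewrite (normal_fanE hgeom ix) => -[x Px ->]; exists x => w xw.
by rewrite (suppE Px xw) dotvC.
Qed.

(** At a minimiser of the sum, each [supp b (col j h)] is at most the value of [col j h]; equality
    of the totals forces equality term by term. *)
Lemma exists_ncone_cone b J : polyhedron h b !=set0 ->
  \sum_(j | `[< J j >]) supp b (col j h) =
    supp b (\sum_(j | `[< J j >]) col j h) ->
  exists2 z, polyhedron h b z &
    cone_of (fun j => col j h) J `<=` ncone h b z.
Proof.
move=> Pb; set w0 := \sum_(j | _) col j h.
have [z Pz zw] := ncone_complete w0 sp Pb.
rewrite (suppE Pz zw) /w0 (big_morph _ (fun u v => dotvDr u v z) (dotv0r z)).
move=> /eqP; rewrite eq_sym -subr_eq0 -sumrB psumr_eq0; last first.
  by move=> j _; rewrite subr_ge0 supp_le.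
move=> /allP E; exists z => // _ [c [c0 cJ ->]].
apply: ncone_sum => j _; have [Jj|/cJ ->] := pselect (J j); last first.
  by rewrite scale0r => y Py; rewrite !dotv0r.
apply: ncone_ge0 => //; apply: ncone_supp => //; apply/eqP.
by have := E j (mem_index_enum j); rewrite asboolT//= subr_eq0.
Qed.

Section CSFTheory.
Variables (a : 'cV[R]_n) (x0 : 'cV[R]_d).
Hypothesis ix : interior_point h a x0.

Lemma CSF_superadditive phi v w : CSF (normal_fan h a) phi ->
  phi v + phi w <= phi (v + w).
Proof. by move=> [_ H]; apply: H; rewrite (fan_support_setT hgeom sp ix). Qed.

Lemma CSF_linear phi x : CSF (normal_fan h a) phi -> polyhedron h a x ->
  exists u, forall w, ncone h a x w -> phi w = dotv w u.
Proof. by move=> [H _] Px; apply: H; rewrite (normal_fanE hgeom ix); exists x. Qed.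

Lemma CSF_scale phi t w : CSF (normal_fan h a) phi -> 0 <= t ->
  phi (t *: w) = t * phi w.
Proof.
move=> F t0; have [x Px xw] := fan_complete w sp ix.
have [u Hu] := CSF_linear F Px.
by rewrite !Hu ?dotvZl//; exact: ncone_ge0.
Qed.

Lemma CSF_0 phi : CSF (normal_fan h a) phi -> phi 0 = 0.
Proof. by move=> F; rewrite -[X in phi X](scale0r 0) CSF_scale// mul0r. Qed.

Lemma CSF_sum phi (P : pred 'I_n) (c : 'I_n -> R) (w : 'I_n -> 'cV[R]_d) :
  CSF (normal_fan h a) phi -> (forall j, 0 <= c j) ->
  \sum_(j | P j) c j * phi (w j) <= phi (\sum_(j | P j) c j *: w j).
Proof.
move=> F c0; elim/big_ind2: _ => [|v v' p p' H H'|j _]; first by rewrite CSF_0.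
  by apply: le_trans (CSF_superadditive _ _ F); rewrite lerD.
by rewrite CSF_scale.
Qed.

(** If the polyhedron were empty, Farkas would give a relation between the [col j h] contradicting
    superadditivity of [phi] at 0. Then [phi] is at most [supp b] because it is linear on cones
    generated by vectors outside [J], and at least [supp b] by superadditivity over the constraints
    tight at a minimiser. *)
Lemma Gamma_lift_supp phi J b : CSF (normal_fan h a) phi ->
  J `<=` virtual_facets h a ->
  (forall j, ~ J j -> phi (col j h) = - b j 0) ->
  (forall i, J i -> - b i 0 <= phi (col i h)) ->
  polyhedron h b !=set0 /\ forall w, phi w = supp b w.
Proof.
move=> F Jv bJ bJ'.
have bge j : - b j 0 <= phi (col j h).
  by have [/bJ'//|/bJ ->] := pselect (J j).
have Pb : polyhedron h b !=set0.
  apply: contrapT => nP; have [|c [c0 cw cb]] :=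
      @affine_farkas R d n (fun j => col j h) (fun j => b j 0).
    by move=> [x Hx]; apply: nP; exists x; apply/polyhedronE.
  have := @CSF_sum phi xpredT c (fun j => col j h) F c0.
  rewrite cw CSF_0// leNgt => /negP; apply.
  rewrite -oppr_gt0 in cb; apply: (lt_le_trans cb).
  by rewrite -sumrN; apply: ler_sum => j _; rewrite -mulrN ler_wpM2l.
split => // w; apply/le_anti/andP; split.
  have [x Px xw] := ncone_complete w sp Pb; rewrite (suppE Px xw).
  have [y Py] := fan_complete w sp ix.
  rewrite (ncone_cone_of (irredundant hgeom ix) Py) => -[c [c0 cy wE]].
  have [u Hu] := CSF_linear F Py.
  have cyE j : c j != 0 -> ~ J j /\ active h a y j.
    move=> /eqP cj; have [[nv yj]|/cy//] :=
      pselect ((~` virtual_facets h a `&` active h a y) j).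
    by split => // /Jv.
  rewrite wE Hu; last first.
    apply: ncone_sum => j _; have [->|/cyE[_ yj]] := eqVneq (c j) 0.
      by rewrite scale0r => z Pz; rewrite !dotv0r.
    by apply: ncone_ge0 => //; exact: active_ncone.
  rewrite dotvC !dotv_sumr; apply: ler_sum => j _.
  have [->|/[dup] cj /cyE[nJ yj]] := eqVneq (c j) 0; first by rewrite !mul0r.
  rewrite ler_wpM2l// dotvC -Hu; last exact: active_ncone.
  by rewrite bJ//; exact: Px.
have [x Px xw] := ncone_complete w sp Pb; rewrite (suppE Px xw).
move: xw; rewrite nconeE// => -[c [c0 cx ->]].
apply: le_trans (@CSF_sum phi xpredT c (fun j => col j h) F c0).
rewrite dotv_sumr; apply: ler_sum => j _.
have [xj|/cx ->] := pselect (active h b x j); last by rewrite !mul0r.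
rewrite ler_wpM2l//; move: xj (bge j); rewrite /active/slack/=; lra.
Qed.

Lemma Gamma_lift_self J : J `<=` virtual_facets h a ->
  (forall j, ~ J j -> exists2 x, polyhedron h a x & active h a x j) ->
  Gamma_lift (normal_fan h a) J a.
Proof.
move=> Jv aJ; exists (supp a); first exact: supp_CSF ix.
split => [j /aJ[x Px xj]|i _]; first exact: supp_col_active xj.
by apply: supp_col_ge; exists x0; exact: interior_polyhedron.
Qed.

End CSFTheory.

Lemma CSF_refine a b x0 y0 phi : interior_point h a x0 -> interior_point h b y0 ->
  (forall y, polyhedron h b y ->
     exists2 x, polyhedron h a x & ncone h b y `<=` ncone h a x) ->
  CSF (normal_fan h a) phi -> CSF (normal_fan h b) phi.
Proof.
move=> ix iy ab F; split => [s|v w _ _ _]; last exact: CSF_superadditive F.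
rewrite (normal_fanE hgeom iy) => -[y /ab[x Px xy] ->].
by have [u Hu] := CSF_linear ix F Px; exists u => w /xy; exact: Hu.
Qed.

End SupportFunctions.

(** * Gale duality and the product structure of secondary cones *)

Section GammaTheory.
Variables (R : realType) (n d : nat) (h : 'M[R]_(d, n)) (k : 'M[R]_(n, n - d)).
Hypothesis hgale : gale_transform h k.
Implicit Types (b a c : 'cV[R]_n) (J : set 'I_n) (Delta : set (set 'cV[R]_d)).

Lemma gale_mul0 : h *m k = 0.
Proof.
apply/matrixP => i j; rewrite [RHS]mxE.
have : [set x | h *m x = 0] (k *m (delta_mx j 0 : 'cV_(n - d))).
  by rewrite -hgale.2; exists (delta_mx j 0).
by move=> /= /(congr1 (fun A : 'cV_d => A i 0)); rewrite mulmxA -colE !mxE.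
Qed.

(** A fibre of [k^T] consists of the translates of one polyhedron: as the image of [k] is the kernel
    of [h], a row that annihilates [k] lies in the row space of [h]. *)
Lemma gale_fiber b c : k^T *m b = k^T *m c -> exists m, c = b + h^T *m m.
Proof.
move=> bc; pose e := c - b.
have ke : e^T *m k = 0.
  by apply: trmx_inj; rewrite trmx_mul trmxK trmx0 mulmxBr bc subrr.
have [T kT] : exists T, cokermx h = k *m T.
  have H (j : 'I_n) : exists t, col j (cokermx h) = k *m t.
    have : [set x | h *m x = 0] (col j (cokermx h)).
      by rewrite /= colE mulmxA mulmx_coker mul0mx.
    by rewrite -hgale.2 => -[t _ <-]; exists t.
  have [f Hf] := choice H; exists (\matrix_(i, j) f j i 0).
  apply/matrixP => i j; have := congr1 (fun A : 'cV_n => A i 0) (Hf j).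
  by rewrite !mxE => ->; apply: eq_bigr => l _; rewrite mxE.
have /submxP[D E] : (e^T <= h)%MS by rewrite submxE kT mulmxA ke mul0mx.
exists D^T; apply/eqP; rewrite addrC -subr_eq; apply/eqP.
by apply: trmx_inj; rewrite E trmx_mul !trmxK.
Qed.

Lemma gale_translate b (m : 'cV[R]_d) : k^T *m (b + h^T *m m) = k^T *m b.
Proof.
by rewrite mulmxDr mulmxA -trmx_mul gale_mul0 trmx0 mul0mx addr0.
Qed.

Lemma Gamma_lift_translate Delta J b (m : 'cV[R]_d) :
  Gamma_lift h Delta J b -> Gamma_lift h Delta J (b + h^T *m m).
Proof.
move=> [phi [lin sup] [bJ bJ']].
exists (fun w => phi w - dotv m w); [split|split] => [s|x y sx sy sxy|j nJ|i Ji].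
- by move=> /lin[u Hu]; exists (u - m) => w /Hu ->; rewrite dotvDr dotvNr (dotvC m).
- have := sup x y sx sy sxy; rewrite dotvDr; lra.
- by rewrite bJ// mxE dotv_col_mx opprD.
- by rewrite mxE dotv_col_mx opprD lerD2r bJ'.
Qed.

Lemma mem_Gamma Delta J b : Gamma h k Delta J (k^T *m b) <-> Gamma_lift h Delta J b.
Proof.
split => [[c cJ /gale_fiber[m ->]]|bJ]; last by exists b.
exact: Gamma_lift_translate.
Qed.

Lemma mul_gale (c : 'cV[R]_n) : k^T *m c = \sum_j c j 0 *: gale_vector k j.
Proof.
apply/colP => i; rewrite mxE summxE; apply: eq_bigr => j _.
by rewrite !mxE mulrC.
Qed.

Lemma Gamma_cone_product Delta J :
  Gamma h k Delta J = cone_product k (Gamma h k Delta set0) J.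
Proof.
apply/seteqP; split => chi.
  move=> [b [phi F [bJ bJ']] <-].
  (* All conditions on [c] are equalities; the nonnegative excess [b - c] is supported on [J] and
     gives the second factor. *)
  pose c := \col_j (- phi (col j h)) : 'cV[R]_n.
  exists (k^T *m c), (k^T *m (b - c)); split.
  - by exists c => //; exists phi => //; split => // j _; rewrite mxE opprK.
  - rewrite mul_gale; exists (fun j => (b - c) j 0); split => // j.
      rewrite !mxE opprK; have [/bJ'|/bJ ->] := pselect (J j); last by rewrite subrr.
      by rewrite -subr_ge0 opprK addrC.
    by move=> /bJ E; rewrite !mxE opprK E subrr.
  - by rewrite -mulmxDr addrC subrK.
move=> [_ [_ [[b [phi F [bJ _]] <-] [c [c0 cJ ->]] ->]]].
pose c' := \col_j c j : 'cV[R]_n.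
have -> : \sum_j c j *: gale_vector k j = k^T *m c'.
  by rewrite mul_gale; apply: eq_bigr => j _; rewrite mxE.
rewrite -mulmxDr; exists (b + c') => //; exists phi => //; split => [j nJ|j Jj].
  by rewrite !mxE cJ// addr0 bJ.
by rewrite !mxE opprD bJ// gerDl oppr_le0.
Qed.

(** Two lifts of one point differ by a translation [m]. Outside [J] the coefficients vanish, so
    [phi'] is [phi] minus the form [m] on the rays, hence everywhere by linearity on cones;
    comparing values at all [col j h] gives [c = c']. *)
Lemma direct_productP a x0 J : geometric_map h -> spanning h ->
  interior_point h a x0 -> J `<=` virtual_facets h a ->
  direct_product k (Gamma h k (normal_fan h a) set0) J.
Proof.
move=> hgeom sp ix Jv _ _ c c' [b [phi F [bE _]] <-] [b' [phi' F' [bE' _]] <-].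
move=> c0 c0' cJ cJ' E.
have galeE (e : 'I_n -> R) :
    \sum_j e j *: gale_vector k j = k^T *m \col_j e j.
  by rewrite mul_gale; apply: eq_bigr => j _; rewrite mxE.
have [m mE] : exists m, b' + \col_j c' j = b + \col_j c j + h^T *m m.
  by apply: gale_fiber; rewrite !mulmxDr -!galeE.
have {}mE j : b' j 0 + c' j = b j 0 + c j + dotv m (col j h).
  by have := congr1 (fun A : 'cV_n => A j 0) mE; rewrite [RHS]mxE dotv_col_mx !mxE.
have phiE w : phi' w = phi w - dotv m w.
  have [x Px] := fan_complete w sp ix.
  have [[u Hu] [u' Hu']] := (CSF_linear hgeom ix F Px, CSF_linear hgeom ix F' Px).
  move=> xw; rewrite Hu// Hu'// (dotvC m).
  suff : dotv w (u' + m - u) = 0 by rewrite !dotvE; lra.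
  move: xw; rewrite (ncone_cone_of (irredundant hgeom ix) Px) => -[e [_ ex ->]].
  rewrite dotvC dotv_sumr big1// => j _.
  have [[nv xj]|/ex ->] :=
      pselect ((~` virtual_facets h a `&` active h a x) j); last by rewrite mul0r.
  have nJ : ~ J j by move=> /Jv.
  have := Hu _ (active_ncone Px xj); have := Hu' _ (active_ncone Px xj).
  have := mE j; rewrite bE// bE'// cJ// cJ'// dotvC !dotvE !(dotvC (col j h)) => ? ? ?.
  by rewrite -[RHS](mulr0 (e j)); congr (_ * _); lra.
have cE j : c j = c' j.
  by have := phiE (col j h); have := mE j; rewrite bE// bE'//; lra.
split => //; move: E; rewrite (eq_bigr (fun j => c' j *: gale_vector k j)).
  exact: addIr.
by move=> j _; rewrite cE.
Qed.

End GammaTheory.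

(** * Perturbation of the constraints *)

Section Perturbation.
Variables (R : realType) (n d : nat) (h : 'M[R]_(d, n)).
Hypothesis hgeom : geometric_map h.
Hypothesis sp : spanning h.
Implicit Types (b a c : 'cV[R]_n) (x y z v w : 'cV[R]_d) (J : set 'I_n).

Lemma slack_perturb b a x v (e : R) j :
  slack h (b + e *: a) (x + e *: v) j =
  slack h b x j + e * (dotv v (col j h) + a j 0).
Proof. by rewrite /slack !dotvE !mxE; ring. Qed.

(** Moving along [v] compensates exactly for [a] on the tight constraints, and the strict ones stay
    strict for small [e]. *)
Lemma near0_active b a x v : polyhedron h b x ->
  (forall j, active h b x j -> dotv v (col j h) = - a j 0) ->
  \forall e \near 0^'+, polyhedron h (b + e *: a) (x + e *: v) /\
    active h (b + e *: a) (x + e *: v) = active h b x.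
Proof.
move=> Px xv.
suff : \forall e \near 0^'+, forall j,
    if slack h b x j == 0 then slack h (b + e *: a) (x + e *: v) j = 0
    else 0 < slack h (b + e *: a) (x + e *: v) j.
  apply: filterS => e He; split.
    by apply/polyhedronE => j; have := He j; case: ifP => [_ ->|_ /ltW].
  apply/seteqP; split => j; rewrite /active/=; have := He j.
    by case: ifP => [/eqP//|_ ev E]; rewrite E ltxx in ev.
  by move=> + xj; rewrite xj eqxx.
apply: near0_forall => j; have [xj|xj] := eqVneq (slack h b x j) 0.
  by apply: nearW => e; rewrite slack_perturb xj xv// addNr mulr0 addr0.
have sx : 0 < slack h b x j.
  by rewrite lt_neqAle eq_sym xj; exact: (polyhedronE _ _ _).1.
apply: filterS (near0_affine_gt0 (dotv v (col j h) + a j 0) sx) => e.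
by rewrite slack_perturb.
Qed.

Lemma near0_interior b a x : interior_point h b x ->
  \forall e \near 0^'+, interior_point h (b + e *: a) x.
Proof.
move=> ix; have xv j : active h b x j -> dotv 0 (col j h) = - a j 0.
  by rewrite (interior_active ix).
apply: filterS (near0_active (interior_polyhedron ix) xv) => e.
by rewrite scaler0 addr0 (interior_active ix) => -[]; exact: active0_interior.
Qed.

(* For a set A of constraints not simultaneously tight on P_b, the minimum over
   P_b of the sum of their slacks is positive, and LP duality shows that it
   varies continuously. *)
Lemma near0_refine b a : polyhedron h b !=set0 ->
  \forall e \near 0^'+, forall x, polyhedron h (b + e *: a) x ->
    exists2 y, polyhedron h b y & active h (b + e *: a) x `<=` active h b y.
Proof.
move=> Pb.
suff : \forall e \near 0^'+, forall A : {set 'I_n}, forall x,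
    polyhedron h (b + e *: a) x ->
    (forall j, j \in A -> active h (b + e *: a) x j) ->
    exists2 y, polyhedron h b y & forall j, j \in A -> active h b y j.
  apply: filterS => e He x Px.
  have [|y Py Hy] := He [set j | `[< active h (b + e *: a) x j >]]%SET x Px.
    by move=> j; rewrite finset.in_set => /asboolP.
  by exists y => // j xj; apply: Hy; rewrite finset.in_set; apply/asboolP.
apply: near0_forall => A; pose w := \sum_(j in A) col j h.
have wE (c : 'cV[R]_n) z : \sum_(j in A) slack h c z j =
    dotv z w + \sum_(j in A) c j 0.
  by rewrite (big_morph _ (fun u v => dotvDr u v z) (dotv0r z)) -big_split.
have [y Py yw] := ncone_complete w sp Pb.
have [y0|y0] := eqVneq (\sum_(j in A) slack h b y j) 0.
  apply: nearW => e x _ _; exists y => // j jA; apply/eqP.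
  move/eqP: y0; rewrite psumr_eq0 => [/allP/(_ j (mem_index_enum j))|i _].
    by rewrite jA.
  exact: (polyhedronE _ _ _).1.
have {}y0 : 0 < \sum_(j in A) slack h b y j.
  rewrite lt_neqAle eq_sym y0 sumr_ge0// => j _; exact: (polyhedronE _ _ _).1.
move: yw; rewrite nconeE// => -[l [l0 ly wl]].
(* The multipliers [l] form a dual solution; [q] is the slope in [e] of the lower bound it gives for
   the total slack over [A]. *)
pose q := \sum_(j in A) a j 0 - \sum_j l j * a j 0.
apply: filterS (near0_affine_gt0 q y0) => e ep x /polyhedronE Px xA.
exfalso; move: ep; rewrite ltNge => /negP; apply.
have : \sum_(j in A) slack h (b + e *: a) x j = 0 by rewrite big1.
have : 0 <= \sum_j l j * slack h (b + e *: a) x j.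
  by apply: sumr_ge0 => j _; rewrite mulr_ge0.
have : \sum_j l j * slack h b y j = 0.
  apply: big1 => j _; have [->|/ly ->] := pselect (active h b y j).
    by rewrite mulr0.
  by rewrite mul0r.
have lE (c : 'cV[R]_n) z :
    \sum_j l j * slack h c z j = dotv z w + \sum_j l j * c j 0.
  by rewrite wl dotv_sumr -big_split/=; apply: eq_bigr => j _; rewrite -mulrDr.
have -> : \sum_j l j * slack h (b + e *: a) x j =
    dotv x w + \sum_j l j * b j 0 + e * \sum_j l j * a j 0.
  rewrite lE -addrA mulr_sumr -big_split/=; congr (_ + _).
  by apply: eq_bigr => j _; rewrite !mxE; ring.
have -> : \sum_(j in A) slack h (b + e *: a) x j =
    dotv x w + \sum_(j in A) b j 0 + e * \sum_(j in A) a j 0.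
  rewrite wE -addrA mulr_sumr -big_split/=; congr (_ + _).
  by apply: eq_bigr => j _; rewrite !mxE.
by rewrite lE wE /q; lra.
Qed.

(** Stronger than virtual: a virtual constraint may still touch the polytope along a face of low
    dimension. *)
Definition untouched b j := forall x, polyhedron h b x -> ~ active h b x j.

Lemma untouched_virtual b j : untouched b j -> virtual_facets h b j.
Proof. by move=> bj [x /facetE[/bj]]. Qed.

Lemma near0_untouched b a : polyhedron h b !=set0 ->
  \forall e \near 0^'+, forall j, untouched b j -> untouched (b + e *: a) j.
Proof.
move=> Pb; apply: filterS (near0_refine a Pb) => e He j bj x Px xj.
by have [y Py /(_ _ xj)] := He x Px; exact: bj.
Qed.

(** A point where only [j] is tight follows the shifted hyperplane by sliding along its normal. *)
Lemma near0_nonvirtual b a :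
  \forall e \near 0^'+, forall j, ~ virtual_facets h b j ->
    exists2 x, polyhedron h (b + e *: a) x & active h (b + e *: a) x = [set j].
Proof.
apply: near0_forall => j.
have [jv|/(nonvirtual_point hgeom)[x Px xE]] := pselect (virtual_facets h b j).
  by apply: nearW.
have hj : dotv (col j h) (col j h) != 0 by rewrite dotv_eq0; exact: hgeom.1.
have /(near0_active Px) : forall l, active h b x l ->
    dotv (- (a j 0 / dotv (col j h) (col j h)) *: col j h) (col l h) = - a l 0.
  by move=> l; rewrite xE => ->; rewrite dotvZl mulNr divfK.
apply: filterS => e [Pe Ee] _; rewrite -xE -Ee.
by exists (x + e *: (- (a j 0 / dotv (col j h) (col j h)) *: col j h)).
Qed.

End Perturbation.

(** * Chambers and simple polytopes *)

Section Chambers.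
Variables (R : realType) (n d : nat) (h : 'M[R]_(d, n)) (k : 'M[R]_(n, n - d)).
Hypothesis hgeom : geometric_map h.
Hypothesis hgale : gale_transform h k.
Hypothesis sp : spanning h.
Implicit Types (b a c : 'cV[R]_n) (x y z v w : 'cV[R]_d) (J I : set 'I_n).

(* P_b is a simple polytope: the normals of the constraints tight at any given
   point are linearly independent. *)
Definition simple b := forall x a, polyhedron h b x ->
  exists v, forall j, active h b x j -> dotv v (col j h) = a j 0.

Definition touched b j := exists2 x, polyhedron h b x & active h b x j.

Lemma nonvirtual_touched b j : ~ virtual_facets h b j -> touched b j.
Proof. by move=> /(nonvirtual_ray hgeom)[x [Px xj _]]; exists x. Qed.

(** A small perturbation in any direction [a] refines the fan, so by maximality its secondary cone
    is the chamber itself. Thus [b + e *: a] lifts to a function linear on the cone at [x], whose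
    slope prescribes the values [a]. *)
Lemma chamber_simple b x0 : interior_point h b x0 ->
  (forall i, virtual_facets h b i -> untouched h b i) ->
  chamber h k (Gamma h k (normal_fan h b) (virtual_facets h b)) -> simple b.
Proof.
move=> ix Iu [_ max] x a Px; set I := virtual_facets h b in Iu max.
have Pb : polyhedron h b !=set0 by exists x.
have [e e0 [[[ie re] ue] ne]] := near0_ex (filterI (filterI (filterI
  (near0_interior a ix) (near0_refine sp a Pb)) (near0_untouched sp a Pb))
  (near0_nonvirtual hgeom b a)).
set c := b + e *: a in ie re ue ne.
have Iv i : I i -> virtual_facets h c i by move=> /Iu/ue/untouched_virtual.
have sub : Gamma h k (normal_fan h b) I `<=` Gamma h k (normal_fan h c) I.
  move=> _ [b' [phi F phib] <-]; exists b' => //; exists phi => //.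
  apply: (CSF_refine hgeom sp ix ie) F => y Py.
  have [z Pz yz] := re y Py; exists z => //; rewrite !nconeE// => w [l [l0 ly ->]].
  by exists l; split => // j nj; apply: ly => /yz.
have sec : secondary_cone h k (Gamma h k (normal_fan h c) I).
  by exists c, I; split => //; exact: interior_full_polytope ie.
have : Gamma h k (normal_fan h b) I (k^T *m c).
  rewrite -(max _ sec sub); apply/(mem_Gamma hgale).
  apply: (Gamma_lift_self hgeom sp ie) => // j /ne[y Py yE].
  by exists y; rewrite ?yE.
move=> /(mem_Gamma hgale)[psi F [psiE _]].
have [u Hu] := CSF_linear hgeom ix F Px.
(* On the tight normals [x] takes the values of [- b] and [u] those of [- c], and [c - b] is
   [e *: a]. *)
exists (e^-1 *: (x - u)) => j xj.
have nI : ~ I j by move=> /Iu/(_ x Px).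
have := Hu _ (active_ncone Px xj); rewrite psiE// !mxE dotvC => uE.
move: xj; rewrite /active/slack/= => xj; rewrite !dotvE -uE.
have -> : dotv x (col j h) = - b j 0 by lra.
by field; rewrite gt_eqF.
Qed.

(** By simplicity each point follows the perturbation with the same tight constraints, so the new
    support function is linear on the old cones. Only finitely many sets of tight constraints occur,
    whence a uniform [e]. *)
Lemma simple_open b x0 J a : interior_point h b x0 -> simple b ->
  (forall j, ~ J j -> touched b j) ->
  \forall e \near 0^'+, Gamma_lift h (normal_fan h b) J (b + e *: a).
Proof.
move=> ix sb Jt.
have near : \forall e \near 0^'+, forall A : {set 'I_n},
    (exists2 y, polyhedron h b y & active h b y = [set` A]) ->
    exists2 z, polyhedron h (b + e *: a) z & active h (b + e *: a) z = [set` A].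
  apply: near0_forall => A.
  have [[y Py yA]|] := pselect
    (exists2 y, polyhedron h b y & active h b y = [set` A]); last by move=> ?; apply: nearW.
  have [v Hv] := sb y (- a) Py.
  have {}Hv j : active h b y j -> dotv v (col j h) = - a j 0.
    by move=> /Hv ->; rewrite mxE.
  apply: filterS (near0_active Py Hv) => e [Pz zE] _.
  by exists (y + e *: v); rewrite ?zE.
apply: filterS2 near (near0_interior a ix) => e He ie.
have {}He y : polyhedron h b y -> exists2 z, polyhedron h (b + e *: a) z &
    active h (b + e *: a) z = active h b y.
  move=> Py; pose A := [set j | `[< active h b y j >]]%SET.
  have AE : [set` A] = active h b y.
    by apply/seteqP; split => j; rewrite /= /A finset.in_set => /asboolP.
  by have [|z Pz zE] := He A; [exists y|exists z; rewrite ?zE].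
have Pe : polyhedron h (b + e *: a) !=set0.
  by exists x0; exact: interior_polyhedron.
exists (supp h (b + e *: a)); [split|split] => [|v w _ _ _|j /Jt[y Py yj]|i _].
- move=> s; rewrite (normal_fanE hgeom ix) => -[y Py ->].
  have [z Pz zE] := He y Py; exists z => w yw; rewrite dotvC.
  by apply: suppE => //; rewrite nconeE// zE -nconeE.
- exact: supp_superadditive.
- have [z Pz zE] := He y Py.
  by rewrite (supp_col_active Pz) ?zE.
- exact: supp_col_ge.
Qed.

(* If phi1 + phi2 is linear on a cone then so are the superadditive functions
   phi1 and phi2: hence a secondary cone containing a neighbourhood of a point
   of Gamma cannot be larger. *)
Lemma open_chamber b x0 : interior_point h b x0 ->
  (forall a, \forall e \near 0^'+,
     Gamma_lift h (normal_fan h b) (virtual_facets h b) (b + e *: a)) ->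
  chamber h k (Gamma h k (normal_fan h b) (virtual_facets h b)).
Proof.
move=> ix op; set I := virtual_facets h b in op *; split.
  by exists b, I; split => //; exact: interior_full_polytope ix.
move=> _ [c [J [fc Jv ->]]] sub; apply/seteqP; split => // _ [b2 [phi2 F2 b2J] <-].
have [y0 iy] := full_polytope_interior hgeom fc.
have : Gamma h k (normal_fan h c) J (k^T *m b).
  apply: sub; apply/(mem_Gamma hgale).
  by apply: (Gamma_lift_self hgeom sp ix) => // j /nonvirtual_touched.
move=> /(mem_Gamma hgale)[phi1 F1 b1J].
(* A point of the segment from [b] to [b2] close to [b] lifts to [psi], linear on the cones of the
   fan of [b]; [psi] and the combination [phi] of [phi1] and [phi2] are both its support
   function. *)
have [e e0 [[psi G psiJ] e1]] := near0_ex (filterI (op (b2 - b)) (nbhs_right_lt ltr01)).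
have e1' : 0 < 1 - e by rewrite subr_gt0.
set b' := b + e *: (b2 - b) in psiJ.
have b'E j : b' j 0 = (1 - e) * b j 0 + e * b2 j 0 by rewrite !mxE; ring.
pose phi w := (1 - e) * phi1 w + e * phi2 w.
have F : CSF (normal_fan h c) phi.
  split => [s sc|v w _ _ _].
    have [[u1 H1] [u2 H2]] := (F1.1 s sc, F2.1 s sc).
    exists ((1 - e) *: u1 + e *: u2) => w sw.
    by rewrite /phi H1// H2// !dotvE.
  have := CSF_superadditive hgeom sp iy v w F1.
  have := CSF_superadditive hgeom sp iy v w F2.
  by rewrite /phi; nra.
have [Pb1 E1] := Gamma_lift_supp hgeom sp iy F1 Jv b1J.1 b1J.2.
have [Pb2 E2] := Gamma_lift_supp hgeom sp iy F2 Jv b2J.1 b2J.2.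
have [_ EF] : polyhedron h b' !=set0 /\ forall w, phi w = supp h b' w.
  apply: (Gamma_lift_supp hgeom sp iy F Jv) => j Jj; rewrite /phi b'E.
    by rewrite b1J.1// b2J.1//; lra.
  by have := b1J.2 j Jj; have := b2J.2 j Jj; nra.
have [_ EG] := Gamma_lift_supp hgeom sp ix G (@subset_refl _ _) psiJ.1 psiJ.2.
have bge j : - b j 0 <= phi1 (col j h) by rewrite E1 supp_col_ge.
have b2ge j : - b2 j 0 <= phi2 (col j h) by rewrite E2 supp_col_ge.
exists b2 => //; exists phi2; [split|split] => [s|v w _ _ _|j nI|//].
- rewrite (normal_fanE hgeom ix) => -[x Px ->].
  have [] := @exists_ncone_cone _ _ _ h sp b2 (active h b x) Pb2.
    have [u Hu] := CSF_linear hgeom ix G Px.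
    pose A := [pred j | `[< active h b x j >]].
    have S f (H : forall v w, f v + f w <= f (v + w)) (H0 : f 0 = 0) :
        \sum_(j in A) f (col j h) <= f (\sum_(j in A) col j h) :> R.
      elim/big_ind2: _ => [|p q p' q' Hp Hq|//]; first by rewrite H0.
      by apply: le_trans (H _ _); rewrite lerD.
    have S1 := S _ (fun v w => CSF_superadditive hgeom sp iy v w F1) (CSF_0 hgeom sp iy F1).
    have S2 := S _ (fun v w => CSF_superadditive hgeom sp iy v w F2) (CSF_0 hgeom sp iy F2).
    (* Equality for the combination and superadditivity of both terms force equality for [phi2]. *)
    have : \sum_(j in A) phi (col j h) = phi (\sum_(j in A) col j h).
      rewrite EF -EG Hu; last by apply: active_sum_ncone.
      rewrite dotvC (big_morph _ (fun u' v => dotvDr u' v u) (dotv0r u)).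
      apply: eq_bigr => j /asboolP xj.
      by rewrite EF -EG Hu ?(dotvC u)//; exact: active_ncone.
    rewrite /phi big_split/= -!mulr_sumr => E.
    rewrite -E2; under eq_bigr do rewrite -E2.
    by apply/eqP; rewrite eq_le; apply/andP; split; [exact: S2|nra].
  move=> z Pz zE; exists z => w; rewrite nconeE// => /zE zw.
  by rewrite E2 dotvC (suppE Pz).
- exact: CSF_superadditive F2.
(* A positive combination of the inequalities [bge] and [b2ge] is an equality here, so both are. *)
- have := psiJ.1 j nI; rewrite EG -EF /phi b'E.
  by have := bge j; have := b2ge j; nra.
Qed.

End Chambers.

(** * Combinations and truncations of polytopes *)

Section FanOperations.
Variables (R : realType) (n d : nat) (h : 'M[R]_(d, n)).
Hypothesis hgeom : geometric_map h.
Hypothesis sp : spanning h.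
Implicit Types (b a c : 'cV[R]_n) (x y z v w : 'cV[R]_d) (J I : set 'I_n).

Lemma interior_ncone b x w : interior_point h b x -> ncone h b x w -> w = 0.
Proof.
move=> ix; rewrite nconeE; last exact: interior_polyhedron.
rewrite (interior_active ix) => -[e [_ e0 ->]].
by apply: big1 => j _; rewrite e0// scale0r.
Qed.

Lemma ncone_interior b x : polyhedron h b x -> (forall w, ncone h b x w -> w = 0) ->
  interior_point h b x.
Proof.
move=> Px x0; apply: (active0_interior Px); apply/seteqP; split => // j xj.
by have /eqP := hgeom.1 j; apply; apply: x0; exact: active_ncone.
Qed.

Lemma touched_active b x j : polyhedron h b x -> touched h b j ->
  ncone h b x (col j h) -> active h b x j.
Proof.
move=> Px [y Py yj] xj; have := ncone_eq Px Py xj (active_ncone Py yj).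
by move: yj; rewrite /active/slack/= => ? ?; lra.
Qed.

(** Normal cones depend only on the set of points, so the constants of virtual constraints may
    change as long as this set does not. *)
Lemma same_polyhedron b c x0 : polyhedron h c = polyhedron h b ->
  interior_point h b x0 ->
  (forall j, ~ virtual_facets h b j -> c j 0 = b j 0) ->
  [/\ interior_point h c x0, normal_fan h c = normal_fan h b
    & virtual_facets h c = virtual_facets h b].
Proof.
move=> Pcb ix cb.
have Ncb x : ncone h c x = ncone h b x by rewrite /ncone Pcb.
have iy : interior_point h c x0.
  apply: ncone_interior; first by rewrite Pcb; exact: interior_polyhedron.
  by move=> w; rewrite Ncb; exact: interior_ncone.
split => //.
  rewrite (normal_fanE hgeom ix) (normal_fanE hgeom iy) Pcb.
  by apply/seteqP; split => _ [x Px ->]; exists x.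
apply/seteqP; split => j; apply: contraPP.
  move=> /[dup] nv /(nonvirtual_ray hgeom)[x [Px xj xE]].
  apply/(nonvirtual_ray hgeom); exists x; rewrite Pcb Ncb; split => //.
  by move: xj; rewrite /active/slack/= cb.
move=> /(nonvirtual_ray hgeom)[x [Px xj xE]].
have := active_ncone Px xj; rewrite {}Ncb {}Pcb in xE Px *.
rewrite {1}(ncone_cone_of (irredundant hgeom ix) Px) => -[e [e0 ex hj]].
(* Some non-virtual generator for [b] lies on the ray of [col j h]; as [h] is geometric, its label
   is [j]. *)
have [l el] : exists l, e l != 0.
  apply: contrapT => /forallNP el; have /eqP := hgeom.1 j; apply; rewrite hj.
  apply: big1 => l _; have /negP := el l; rewrite negbK => /eqP ->.
  by rewrite scale0r.
have [[nv xl]|/ex E] := pselect ((~` virtual_facets h b `&` active h b x) l).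
  by have := active_ncone Px xl; rewrite xE => /(ray_inj hgeom) ->.
by rewrite E eqxx in el.
Qed.

(** Each [x] is combined with a point [x2] of the second polyhedron minimising all forms of
    [ncone h b1 x], which exists since [phi2] is linear on that cone. A summand linear on the cones
    leaves the normal cones unchanged, and the constraints of [J], strict for [b1], stay strict. *)
Lemma fan_segment b1 x0 J b2 (s : R) : interior_point h b1 x0 ->
  J `<=` virtual_facets h b1 -> (forall j, J j -> untouched h b1 j) ->
  (forall j, ~ J j -> touched h b1 j) ->
  Gamma_lift h (normal_fan h b1) J b2 -> 0 < s < 1 ->
  let b := (1 - s) *: b1 + s *: b2 in
  [/\ full_polytope h b, normal_fan h b = normal_fan h b1
    & virtual_facets h b = virtual_facets h b1].
Proof.
move=> ix Jv Ju Jt [phi2 F2 b2J] /andP[s0 s1] b.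
have s1' : 0 < 1 - s by rewrite subr_gt0.
have Pb1 : polyhedron h b1 !=set0 by exists x0; exact: interior_polyhedron.
have [Pb2 E2] := Gamma_lift_supp hgeom sp ix F2 Jv b2J.1 b2J.2.
have bE j : b j 0 = (1 - s) * b1 j 0 + s * b2 j 0 by rewrite !mxE.
pose phi w := (1 - s) * supp h b1 w + s * phi2 w.
have F1 := supp_CSF hgeom sp ix.
have F : CSF (normal_fan h b1) phi.
  split => [t tc|v w _ _ _].
    have [[u1 H1] [u2 H2]] := (F1.1 t tc, F2.1 t tc).
    exists ((1 - s) *: u1 + s *: u2) => w tw.
    by rewrite /phi H1// H2// !dotvE.
  have := CSF_superadditive hgeom sp ix v w F1.
  have := CSF_superadditive hgeom sp ix v w F2.
  by rewrite /phi; nra.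
have b1t j : ~ J j -> supp h b1 (col j h) = - b1 j 0.
  by move=> /Jt[x Px xj]; exact: supp_col_active xj.
have phit j : ~ J j -> phi (col j h) = - b j 0.
  by move=> nJ; rewrite /phi bE b2J.1// b1t//; lra.
have phiu j : J j -> - b j 0 < phi (col j h).
  move=> Jj; have [x Px xw] := ncone_complete (col j h) sp Pb1.
  have : - b1 j 0 < supp h b1 (col j h).
    rewrite (suppE Px xw) lt_neqAle (Px j) andbT; apply/eqP => xj.
    by apply: (Ju j Jj x Px); rewrite /active/slack/= -xj addNr.
  by have := b2J.2 j Jj; rewrite /phi bE; nra.
have [Pb E] := Gamma_lift_supp hgeom sp ix F Jv phit (fun j Jj => ltW (phiu j Jj)).
have key x : polyhedron h b1 x -> exists z, [/\ polyhedron h b z,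
    ncone h b z = ncone h b1 x &
    forall j, ~ J j -> active h b1 x j -> active h b z j].
  move=> Px; have [u Hu] := CSF_linear hgeom ix F2 Px.
  have [|x2 Px2 x2E] := @exists_ncone_cone _ _ _ h sp b2 (active h b1 x) Pb2.
    rewrite -!E2 (Hu _ (active_sum_ncone Px)) dotvC.
    rewrite (big_morph _ (fun u' v => dotvDr u' v u) (dotv0r u)).
    apply: eq_bigr => j /asboolP xj.
    by rewrite -E2 Hu ?(dotvC u)//; exact: active_ncone.
  have Pz : polyhedron h b ((1 - s) *: x + s *: x2).
    apply/polyhedronE => j; rewrite slackD addr_ge0// mulr_ge0 ?(ltW s0) ?(ltW s1')//.
      exact: (polyhedronE _ _ _).1.
    exact: (polyhedronE _ _ _).1.
  have zE : ncone h b ((1 - s) *: x + s *: x2) = ncone h b1 x.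
    apply/seteqP; split => w.
      move=> zw; apply: ncone_supp => //.
      have := suppE Pz zw; rewrite -E /phi E2 !dotvE.
      have := supp_le sp w Px; have := supp_le sp w Px2; nra.
    move=> xw; apply: ncone_supp => //; rewrite -E /phi E2 (suppE Px xw) !dotvE.
    by rewrite (suppE Px2)//; apply: x2E; rewrite -nconeE.
  exists ((1 - s) *: x + s *: x2); split => // j nJ xj.
  have zj : ncone h b ((1 - s) *: x + s *: x2) (col j h).
    by rewrite zE; exact: active_ncone.
  have := suppE Pz zj; rewrite -E phit// /active/slack/= => <-.
  by rewrite addNr.
have [z0 [Pz0 z0E _]] := key x0 (interior_polyhedron ix).
have iz : interior_point h b z0.
  by apply: ncone_interior => // w; rewrite z0E; exact: interior_ncone.
have fanE : normal_fan h b = normal_fan h b1.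
  apply/esym/(normal_fan_sub_eq hgeom sp ix iz).
  rewrite (normal_fanE hgeom ix) (normal_fanE hgeom iz) => _ [x Px ->].
  by have [z [Pz zE _]] := key x Px; exists z.
split => //; first exact: interior_full_polytope iz.
apply/seteqP; split => j; apply: contraPP => /[dup] nv /(nonvirtual_ray hgeom)[x [Px xj xE]].
  have [z [Pz zE zj]] := key x Px.
  apply/(nonvirtual_ray hgeom); exists z; split; rewrite ?zE//.
  by apply: zj => // /Jv.
have nJ : ~ J j.
  move=> /phiu; rewrite E => H; have := lt_le_trans H (supp_le sp (col j h) Px).
  by move: xj; rewrite /active/slack/= => xj; lra.
have : normal_fan h b1 (ray (col j h)).
  by rewrite -fanE (normal_fanE hgeom iz); exists x.
rewrite (normal_fanE hgeom ix) => -[y Py yE].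
apply/(nonvirtual_ray hgeom); exists y; split => //.
apply: touched_active => //; first exact: Jt.
by rewrite -yE; exists 1; rewrite ?scale1r.
Qed.

(** * Truncation of a face and star subdivision *)

Section Cut.
Variables (b : 'cV[R]_n) (x0 : 'cV[R]_d) (i : 'I_n).
Hypothesis ix : interior_point h b x0.
Hypothesis it : touched h b i.
Hypothesis iv : virtual_facets h b i.

(* P_b truncated near the face on which h(e_i) is minimal *)
Definition cut (e : R) := b + e *: - delta_mx i 0.

Lemma slack_cut e x j : slack h (cut e) x j = slack h b x j - e * (j == i)%:R.
Proof. by rewrite /slack /cut !mxE eqxx andbT mulrN addrA. Qed.

Lemma cut_polyhedron e x : 0 < e ->
  polyhedron h (cut e) x -> polyhedron h b x /\ e <= slack h b x i.
Proof.
move=> e0 /polyhedronE Px; split; last first.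
  by have := Px i; rewrite slack_cut eqxx mulr1 subr_ge0.
apply/polyhedronE => j; have := Px j; rewrite slack_cut subr_ge0; apply: le_trans.
by rewrite mulr_ge0 ?(ltW e0)// ler0n.
Qed.

Lemma polyhedron_cut e x : polyhedron h b x -> e <= slack h b x i ->
  polyhedron h (cut e) x.
Proof.
move=> /polyhedronE Px xe; apply/polyhedronE => j; rewrite slack_cut.
by have [->|] := eqVneq j i; rewrite ?mulr1 ?mulr0 ?subr0// subr_ge0.
Qed.

Lemma active_cut e x j : j != i -> active h (cut e) x j = active h b x j.
Proof. by move=> /negbTE ji; rewrite /active/= slack_cut ji mulr0 subr0. Qed.

Lemma cut_above e x : 0 < e -> e < slack h b x i ->
  active h (cut e) x = active h b x.
Proof.
move=> e0 xe; apply/seteqP; split => j; have [->|/(active_cut e x) <-//] := eqVneq j i.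
  by rewrite /active/= slack_cut eqxx mulr1 => /eqP; rewrite subr_eq0 gt_eqF.
by rewrite /active/= => E; move: (lt_trans e0 xe); rewrite E ltxx.
Qed.

Lemma cut_on e x : 0 < e -> slack h b x i = e ->
  active h (cut e) x = i |` active h b x.
Proof.
move=> e0 xe; apply/seteqP; split => j.
  have [->|/[dup] ji /(active_cut e x) ->] := eqVneq j i; first by left.
  by right.
have [-> _|/[dup] ji /(active_cut e x) ->] := eqVneq j i.
  by rewrite /active/= slack_cut eqxx mulr1 xe subrr.
by move=> [/eqP|//]; rewrite (negbTE ji).
Qed.

Lemma ncone_above e x : 0 < e -> polyhedron h b x -> e < slack h b x i ->
  ncone h (cut e) x = ncone h b x.
Proof.
by move=> e0 Px xe; rewrite !nconeE ?cut_above//; apply: polyhedron_cut => //; exact: ltW.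
Qed.

Lemma ncone_on e x : 0 < e -> polyhedron h b x -> slack h b x i = e ->
  ncone h (cut e) x = cone_join (ncone h b x) (col i h).
Proof.
move=> e0 Px xe; have nxi : ~ active h b x i.
  by rewrite /active/= xe => E; rewrite E ltxx in e0.
have Pc : polyhedron h (cut e) x by apply: polyhedron_cut; rewrite ?xe.
rewrite (nconeE Px) (nconeE Pc) cut_on//; apply/seteqP; split => w.
  move=> [c [c0 cx ->]]; exists (\sum_(j | j != i) c j *: col j h), (c i).
  split => //; last by rewrite (bigD1 i)//= addrC.
  exists (fun j => if j == i then 0 else c j); split => [j|j nj|].
  - by case: ifP.
  - by case: (eqVneq j i) => // /eqP ji; apply: cx => -[].
  - rewrite [RHS](bigD1 i)//= eqxx scale0r add0r.
    by apply: eq_bigr => j /negbTE ->.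
move=> [_ [t [[c [c0 cx ->]] t0 ->]]].
exists (fun j => if j == i then t else c j); split => [j|j nj|].
- by case: ifP.
- case: (eqVneq j i) => [ji|_]; first by case: nj; left.
  by apply: cx => xj; apply: nj; right.
- rewrite (bigD1 i)//= (cx i)// scale0r add0r [RHS](bigD1 i)//= eqxx addrC.
  by congr (_ + _); apply: eq_bigr => j /negbTE ->.
Qed.

Lemma near0_above : \forall e \near 0^'+, forall x, polyhedron h b x ->
  ~ active h b x i ->
  exists y, [/\ polyhedron h b y, active h b y = active h b x & e < slack h b y i].
Proof.
have : \forall e \near 0^'+, forall A : {set 'I_n}, i \notin A ->
    (exists2 y, polyhedron h b y & active h b y = [set` A]) ->
    exists y, [/\ polyhedron h b y, active h b y = [set` A] & e < slack h b y i].
  apply: near0_forall => A; have [|iA] := boolP (i \in A); first by move=> _; apply: nearW.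
  have [[y Py yA]|] := pselect
    (exists2 y, polyhedron h b y & active h b y = [set` A]); last by move=> ?; apply: nearW.
  have yi : 0 < slack h b y i.
    rewrite lt_neqAle (polyhedronE _ _ _).1// andbT eq_sym; apply/eqP => yi.
    have : [set` A] i by rewrite -yA.
    by rewrite /= (negbTE iA).
  by apply: filterS (nbhs_right_lt yi) => e ey _ _; exists y.
apply: filterS => e He x Px xi; pose A := [set j | `[< active h b x j >]]%SET.
have AE : [set` A] = active h b x.
  by apply/seteqP; split => j; rewrite /= /A finset.in_set => /asboolP.
rewrite -AE; apply: He; last by exists x.
by rewrite finset.in_set; apply/asboolP.
Qed.

(** Points beyond the new hyperplane give the cones without [col i h], points on it the joins.
    Conversely, for a join over [ncone h b x], the segment from [y] on the truncated face to a point
    [z] with the tight constraints of [x] crosses the new hyperplane where exactly these are tight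
    for [b]. *)
Lemma near0_star : \forall e \near 0^'+,
  normal_fan h (cut e) = star_subdivision (normal_fan h b) (col i h).
Proof.
have Pb : polyhedron h b !=set0 by exists x0; exact: interior_polyhedron.
apply: filterS3 (near0_refine sp (- delta_mx i 0) Pb) near0_above
  (filterI (nbhs_right_gt 0) (near0_interior (- delta_mx i 0) ix)).
move=> e ref above [e0 ic]; rewrite -/(cut e) in ic.
have nxi x : polyhedron h b x -> ~ ncone h b x (col i h) -> ~ active h b x i.
  by move=> Px; apply: contra_not; exact: active_ncone.
rewrite /star_subdivision (normal_fanE hgeom ix) (normal_fanE hgeom ic).
apply/seteqP; split => s.
  move=> [x Pc ->]; have [Px xe] := cut_polyhedron e0 Pc.
  have xi : ~ ncone h b x (col i h).
    move=> /(touched_active Px it); rewrite /active/= => E.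
    by move: xe; rewrite E leNgt e0.
  move: xe; rewrite le_eqVlt => /predU1P[xe|xe].
    right; exists (ncone h b x); split => //; [by exists x| |exact: ncone_on].
    have [y Py xy] := ref x Pc; exists (ncone h b y).
    rewrite -/(cut e) cut_on// in xy.
    split; first by exists y.
      by apply: active_ncone => //; apply: xy; left.
    by apply: ncone_mono => // j xj; apply: xy; right.
  by left; rewrite ncone_above//; split => //; exists x.
move=> [[[x Px ->] /(nxi _ Px) xi]|[t [[x Px ->] /(nxi _ Px) xi]]].
  have [y [Py yx ye]] := above x Px xi; exists y.
    by apply: polyhedron_cut => //; exact: ltW.
  by rewrite ncone_above// !nconeE// yx.
move=> [_ [[y Py ->] /(touched_active Py it) yi xy]] ->.
have [z [Pz zx ze]] := above x Px xi.
have zi0 := lt_trans e0 ze.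
pose t' := e / slack h b z i.
have t0 : 0 < t' by rewrite divr_gt0.
have t1 : t' < 1 by rewrite ltr_pdivrMr ?mul1r.
have Pu : polyhedron h b ((1 - t') *: y + t' *: z).
  by apply: polyhedron_conv => //; rewrite !ltW.
have ue : slack h b ((1 - t') *: y + t' *: z) i = e.
  by rewrite slack_conv yi mulr0 add0r divfK ?gt_eqF.
exists ((1 - t') *: y + t' *: z); first by apply: polyhedron_cut; rewrite ?ue.
rewrite ncone_on// [in RHS]nconeE// conv_active ?t0// zx nconeE//.
congr (cone_join (cone_of _ _) _).
apply/seteqP; split => [j xj|j []//]; split => //.
apply: touched_active => //; first by exists x.
by apply: xy; exact: active_ncone.
Qed.

(** The new facet is detected where a segment from the truncated face to the interior point [x0]
    crosses the new hyperplane: only [i] is tight there. *)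
Lemma near0_cut_virtual :
  (forall j, virtual_facets h b j -> j != i -> untouched h b j) ->
  \forall e \near 0^'+, virtual_facets h (cut e) = virtual_facets h b `\ i.
Proof.
move=> ju; have Pb : polyhedron h b !=set0 by exists x0; exact: interior_polyhedron.
apply: filterS3 (near0_untouched sp (- delta_mx i 0) Pb)
  (near0_nonvirtual hgeom b (- delta_mx i 0))
  (filterI (nbhs_right_gt 0) (near0_interior (- delta_mx i 0) ix)).
move=> e un nv [e0 ic]; apply/seteqP; split => j; last first.
  by move=> [jv /eqP ji]; apply/untouched_virtual/un/ju.
move=> jv; have nve l : ~ virtual_facets h b l -> ~ virtual_facets h (cut e) l.
  by move=> /nv[x Px xE]; exact: (active1_nonvirtual hgeom Px).
split; first by apply: contrapT => /nve.
move=> /= ji; move: jv; rewrite ji.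
have [y Py yi] := it.
have Px0 := interior_polyhedron ix.
have xe : e < slack h b x0 i.
  by have := ic i; rewrite -/(cut e) slack_cut eqxx mulr1 subr_gt0.
have zi0 := lt_trans e0 xe.
pose t := e / slack h b x0 i.
have t0 : 0 < t by rewrite divr_gt0.
have t1 : t < 1 by rewrite ltr_pdivrMr ?mul1r.
have Pu : polyhedron h b ((1 - t) *: y + t *: x0).
  by apply: polyhedron_conv => //; rewrite !ltW.
have ue : slack h b ((1 - t) *: y + t *: x0) i = e.
  by rewrite slack_conv yi mulr0 add0r divfK ?gt_eqF.
apply: (active1_nonvirtual hgeom (x := (1 - t) *: y + t *: x0)).
  by apply: polyhedron_cut; rewrite ?ue.
rewrite cut_on// conv_active ?t0// (interior_active ix) setI0.
apply/seteqP; split => l; [by move=> [|[]]|by move=> ->; left].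
Qed.

(* The normals of the facets of P_b through a point of F_i are independent and
   their cone contains h(e_i), so h(e_i) is independent of any subfamily whose
   cone does not contain it. *)
Lemma near0_cut_simple :
  (forall x a, polyhedron h b x ->
     exists v, forall j, j != i -> active h b x j -> dotv v (col j h) = a j 0) ->
  \forall e \near 0^'+, simple h (cut e).
Proof.
move=> sb; have Pb : polyhedron h b !=set0 by exists x0; exact: interior_polyhedron.
apply: filterS2 (near0_refine sp (- delta_mx i 0) Pb) (nbhs_right_gt 0).
move=> e ref e0 x a Pc; have [Px xe] := cut_polyhedron e0 Pc.
have nxi : ~ active h b x i.
  by rewrite /active/= => E; move: xe; rewrite E leNgt e0.
move: xe; rewrite le_eqVlt => /predU1P[xe|xe]; last first.
  rewrite cut_above//; have [v Hv] := sb x a Px; exists v => j xj.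
  by apply: Hv => //; apply/eqP => ji; apply: nxi; rewrite -ji.
have [y Py] := ref x Pc; rewrite -/(cut e) cut_on// => xy.
have yi : active h b y i by apply: xy; left.
have := active_ncone Py yi.
rewrite (ncone_cone_of (irredundant hgeom ix) Py) => -[l [l0 ly hi]].
(* Otherwise [col i h] would lie in the normal cone of [x]. The value of [v] on [col j0 h] is thus
   free. *)
have [j0 lj0 xj0] : exists2 j, l j != 0 & ~ active h b x j.
  apply: contrapT => /forall2NP H; apply: nxi; apply: (touched_active Px it).
  rewrite hi; apply: ncone_sum => j _.
  have [/negP|/contrapT xj] := H j; last first.
    by apply: ncone_ge0 => //; exact: active_ncone.
  by rewrite negbK => /eqP ->; rewrite scale0r => z _; rewrite !dotv0r.
have lE j : l j != 0 -> j != i /\ active h b y j.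
  move=> /eqP lj; have [[nv yj]|/ly//] :=
    pselect ((~` virtual_facets h b `&` active h b y) j).
  by split => //; apply/eqP => ji; apply: nv; rewrite ji.
pose a0 j := if j == j0 then 0 else a j 0.
(* The value on [col j0 h] for which the relation [hi] yields [a i 0] on [col i h]. *)
pose t := (a i 0 - \sum_j l j * a0 j) / l j0.
pose a' := \col_j (if j == j0 then t else a j 0) : 'cV[R]_n.
have [v Hv] := sb y a' Py; exists v => j [->|xj].
  have [j0i yj0] := lE _ lj0; rewrite hi dotv_sumr (bigD1 j0)//= Hv//.
  rewrite mxE eqxx [l j0 * t]mulrC divfK// (bigD1 j0 (F := fun j => l j * a0 j))//=.
  rewrite {1}/a0 eqxx mulr0 add0r -[RHS]addr0 -addrA; congr (_ + _).
  apply/eqP; rewrite addrC subr_eq0; apply/eqP/eq_bigr => j' j'0.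
  have [->|lj'] := eqVneq (l j') 0; first by rewrite !mul0r.
  have [j'i yj'] := lE _ lj'.
  by rewrite Hv// mxE /a0 (negbTE j'0).
rewrite Hv; first 1 last.
- by apply/eqP => ji; apply: nxi; rewrite -ji.
- by apply: xy; right.
rewrite mxE; case: eqP => // jj0; by rewrite jj0 in xj.
Qed.

End Cut.

End FanOperations.

(** * Dimension of analytic sets *)

Section AnalyticDimension.
Variable K : numFieldType.

Lemma injective_linear_mx n q (L : {linear 'cV[K]_q -> 'cV[K]_n}) :
  injective L -> exists2 A : 'M[K]_(n, q), \rank A = q & forall v, L v = A *m v.
Proof.
move=> inj; pose A := \matrix_(i, j) (L (delta_mx j 0) i 0) : 'M[K]_(n, q).
have LA v : L v = A *m v.
  have {1}-> : v = \sum_j v j 0 *: delta_mx j 0.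
    apply/colP => i; rewrite summxE (bigD1 i)//= big1 => [|j ji].
      by rewrite !mxE !eqxx mulr1 addr0.
    by rewrite !mxE eq_sym (negbTE ji) mulr0.
  rewrite linear_sum; apply/colP => i; rewrite summxE mxE.
  by apply: eq_bigr => j _; rewrite linearZ !mxE mulrC.
exists A => //; apply/eqP; rewrite -mxrank_tr -/(row_free A^T) -kermx_eq0.
apply/eqP/row_matrixP => j; rewrite row0.
have : A *m (row j (kermx A^T))^T = 0.
  by apply: trmx_inj; rewrite trmx_mul trmxK -row_mul mulmx_ker row0 trmx0.
rewrite -LA -(linear0 L) => /inj/(congr1 trmx).
by rewrite trmxK trmx0.
Qed.

Lemma contains_manifold_leq n (Z : set 'cV[K]_n) q :
  contains_manifold Z q -> (q <= n)%N.
Proof.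
move=> [U [f [_ [x Ux] _ /(_ x Ux)[_ /injective_linear_mx[A rA _]]]]].
by rewrite -rA rank_leq_row.
Qed.

(** The [i]-th coordinate of [f] is zero near [x], so the injective differential takes values in a
    hyperplane. *)
Lemma contains_manifold_hyperplane n (Z : set 'cV[K]_n) q (i : 'I_n) :
  (forall z, Z z -> z i 0 = 0) -> contains_manifold Z q -> (q <= n.-1)%N.
Proof.
move=> Z0 [U [f [oU [x Ux] fU /(_ x Ux)[df /injective_linear_mx[A rA dfE]]]]].
pose g (y : 'cV[K]_n) : K := y i 0.
have dg y : differentiable (g : 'cV[K]_n -> K^o) y by exact: differentiable_coord.
have gl : linear (g : 'cV[K]_n -> K^o) by move=> c u v; rewrite /g !mxE.
have dgE y v : 'd (g : 'cV[K]_n -> K^o) y v = v i 0.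
  pose glM := GRing.isLinear.Build _ _ _ _ _ gl.
  pose gL : {linear 'cV[K]_n -> K^o} := HB.pack (g : 'cV[K]_n -> K^o) glM.
  by rewrite (_ : g = gL)// (@diff_lin _ _ _ gL)//; exact: coord_continuous.
have dgf (v : 'cV[K]_q) : (A *m v) i 0 = 0.
  rewrite -dfE -(dgE (f x)).
  have := diff_comp df (dg (f x)) => /(congr1 (@^~ v)) /= <-.
  rewrite -deriveE; last exact: differentiable_comp.
  rewrite (@near_eq_derive _ _ _ _ (cst 0)) ?derive_cst//.
  have : \forall y \near x, U y by exact: open_nbhs_nbhs.
  by apply: filterS => y Uy; rewrite /= /g Z0//; apply: fU; exists y.
have iA : ((delta_mx 0 i : 'rV[K]_n) <= kermx A)%MS.
  rewrite sub_kermx -rowE; apply/eqP/rowP => j.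
  by have := dgf (delta_mx j 0); rewrite -colE !mxE.
have := mxrankS iA; rewrite mxrank_delta mxrank_ker rA subn_gt0.
by case: (n) => // m; rewrite ltnS.
Qed.

Lemma open_torus p : open [set w : 'cV[K]_p | forall j, w j 0 != 0].
Proof.
rewrite openE => w /= w0.
suff w0n j : nbhs w [set v : 'cV[K]_p | v j 0 != 0] by exact: filter_forall w0n.
have o0 : open [set t : K^o | t != 0].
  rewrite (_ : [set _ | _] = ~` [set 0]).
    apply: closed_openC; apply: accessible_closed_set1.
    exact/hausdorff_accessible/norm_hausdorff.
  by apply/seteqP; split => t /= /eqP.
apply: (@coord_continuous K p 1 j 0 w [set t : K^o | t != 0]).
by apply: open_nbhs_nbhs; split => //; exact: w0.
Qed.

Lemma differentiable_mulmx n p (M : 'M[K]_(n, p)) w :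
  differentiable (mulmx M : 'cV[K]_p -> 'cV[K]_n) w.
Proof.
have -> : mulmx M = \sum_(j < p) (fun v : 'cV[K]_p => (v j 0 : K^o) *: col j M).
  apply/funext => v; rewrite fct_sumE; apply/colP => i; rewrite summxE mxE.
  by apply: eq_bigr => j _; rewrite !mxE mulrC.
apply: differentiable_sum => j.
exact/differentiableZl/differentiable_coord.
Qed.

Lemma mulmx_continuous n p (M : 'M[K]_(n, p)) :
  continuous (mulmx M : 'cV[K]_p -> 'cV[K]_n).
Proof. by move=> w; exact/differentiable_continuous/differentiable_mulmx. Qed.

Lemma linear_immersion n p (M : 'M[K]_(n, p)) (Z : set 'cV[K]_n) :
  injective (mulmx M : 'cV_p -> 'cV_n) ->
  (forall w : 'cV_p, (forall j, w j 0 != 0) -> Z (M *m w)) -> contains_manifold Z p.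
Proof.
move=> inj MZ; exists [set w | forall j, w j 0 != 0], (mulmx M); split.
- exact: open_torus.
- by exists (const_mx 1) => j; rewrite mxE oner_neq0.
- by move=> _ [w w0 <-]; exact: MZ.
- move=> w _; split; first exact: differentiable_mulmx.
  by rewrite (@diff_lin _ _ _ (mulmx M))//; exact: mulmx_continuous.
Qed.

End AnalyticDimension.

(** * Codimension of an exceptional locus *)

Section Codimension.
Variables (R : realType) (n d : nat).
Implicit Types (h : 'M[R]_(d, n)) (k : 'M[R]_(n, n - d)).
Implicit Types (Delta : set (set 'cV[R]_d)) (I : set 'I_n).

Lemma codimension_coordinate h k Delta1 I1 Delta2 I2 (i : 'I_n) s :
  maximal_cone Delta1 s -> cone_rays h I1 s i -> I2 i ->
  (forall z, exceptional_atlas h Delta1 I1 Delta2 I2 z -> z i 0 = 0) ->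
  codimension (exceptional_locus h k Delta1 I1 Delta2 I2) 1.
Proof.
move=> ms si I2i Z0; have n0 : (0 < n)%N := leq_ltn_trans (leq0n i) (ltn_ord i).
exists n, n.-1; split; last by rewrite addn1 prednK.
  split => [|q]; last exact: contains_manifold_leq.
  apply: (@linear_immersion _ _ _ 1%:M) => [u v|w w0]; first by rewrite !mul1mx.
  by exists s => // j _; rewrite mul1mx.
split => [|q]; last by apply: contains_manifold_hyperplane; exact: Z0.
(* The inclusion of the hyperplane of vectors with zero [i]-th coordinate. *)
pose M := \matrix_(r, c) (r == lift i c)%:R : 'M[R[i]%C]_(n, n.-1).
have Ml (w : 'cV[R[i]%C]_n.-1) c : (M *m w) (lift i c) 0 = w c 0.
  rewrite mxE (bigD1 c)//= big1 => [|c' cc']; rewrite mxE.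
    by rewrite eqxx mul1r addr0.
  by rewrite (inj_eq (@lift_inj _ _)) eq_sym (negbTE cc') mul0r.
have Mi (w : 'cV[R[i]%C]_n.-1) : (M *m w) i 0 = 0.
  by rewrite mxE big1// => c _; rewrite mxE (negbTE (neq_lift i c)) mul0r.
apply: (@linear_immersion _ _ _ M) => [u v uv|w w0].
  by apply/colP => c; rewrite -!Ml uv.
split.
  exists s => // j; have [c ->|->//] := unliftP i j; by rewrite Ml.
move=> [t _ /(_ i)]; rewrite Mi eqxx => H.
by apply/notF/H => -[nI _]; apply: nI; right.
Qed.

End Codimension.

(** * Interior and relative interior points *)

Section GaleTopology.
Variables (R : realType) (n d : nat) (h : 'M[R]_(d, n)) (k : 'M[R]_(n, n - d)).
Hypothesis hgale : gale_transform h k.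

Lemma gale_right_inverse : exists S, k^T *m S = 1%:M.
Proof.
have [A rA kA] := @injective_linear_mx _ _ _ (mulmx k) hgale.1.
have {}kA : k = A.
  apply/matrixP => i j; have := kA (delta_mx j 0).
  by rewrite /= -!colE => /colP/(_ i); rewrite !mxE.
by apply/row_freeP; rewrite /row_free mxrank_tr kA rA.
Qed.

Lemma dotv_gale (b : 'cV[R]_n) (u : 'cV[R]_(n - d)) :
  dotv (k^T *m b) u = dotv b (k *m u).
Proof. by rewrite !dotv_mx trmx_mul trmxK mulmxA. Qed.

(** Translation by [x0] replaces the coordinates of [b] by positive slacks; a linear section of
    [k^T] lifts nearby points to vectors with nonnegative coordinates. *)
Lemma interior_gale_cone b x0 : interior_point h b x0 ->
  interior (cone_of (gale_vector k) setT) (k^T *m b).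
Proof.
move=> ix; have [S kS] := gale_right_inverse.
pose c := b + h^T *m x0; have c0 j : 0 < c j 0.
  by have := ix j; rewrite /slack mxE dotv_col_mx addrC.
rewrite -(gale_translate hgale b x0) -/c.
have near j : \forall y \near k^T *m c,
    (S *m (k^T *m c)) j 0 - c j 0 < (S *m y) j 0.
  have cS : continuous (fun y : 'cV[R]_(n - d) => (S *m y) j 0 : R^o).
    move=> y; apply: (@continuous_comp _ _ _ (mulmx S) (fun z => z j 0)).
      exact: mulmx_continuous.
    exact: coord_continuous.
  by apply: cvgr_gt (cS _) _ _; rewrite ltrBlDr ltrDl.
rewrite /interior/=; apply: filterS (filter_forall (nbhs_filter _) near) => y Hy.
pose l := c + S *m (y - k^T *m c).
have -> : y = k^T *m l.
  by rewrite mulmxDr mulmxA kS mul1mx addrC subrK.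
rewrite (mul_gale k); exists (fun j => l j 0); split => // [j|j []//].
have -> : l j 0 = c j 0 + ((S *m y) j 0 - (S *m (k^T *m c)) j 0).
  by rewrite /l mulmxBr mxE; congr (_ + _); rewrite mxE; congr (_ + _); rewrite mxE.
by have := Hy j; lra.
Qed.

End GaleTopology.

(** The segment from [y] to [x] can be prolonged a little beyond [x] within the affine hull. *)
Lemma relative_interior_segment (R : realType) (m : nat) (W : set 'cV[R]_m) x y :
  relative_interior W x -> W y ->
  exists z (s : R), [/\ W z, 0 < s < 1 & x = (1 - s) *: y + s *: z].
Proof.
move=> [Wx /nbhs_ballP[e /= e0 He]] Wy.
pose t := e / (`|x - y| + 1) / 2.
have N0 : 0 < `|x - y| + 1 by rewrite ltr_wpDl.
have t0 : 0 < t by rewrite !divr_gt0.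
exists (x + t *: (x - y)), (1 + t)^-1; split.
- apply: He.
    rewrite -ball_normE /= opprD addNKr normrN normrZ gtr0_norm//.
    rewrite /t mulrAC ltr_pdivrMr// mulrAC ltr_pdivrMr//.
    have := normr_ge0 (x - y); nra.
  exists 2, (fun j => if j == 0 then x else y), (fun j => if j == 0 then 1 + t else - t).
  split.
  + by move=> j; case: ifP.
  + by rewrite !big_ord_recl big_ord0 /= addr0 addrK.
  + rewrite !big_ord_recl big_ord0 /= addr0 scalerDl scale1r scaleNr -addrA.
    by rewrite scalerBr.
- by rewrite invr_gt0 invf_lt1 addr_gt0//= ltrDl t0.
- apply: (scalerI (a := 1 + t)); first by rewrite gt_eqF// addr_gt0.
  rewrite scalerDr !scalerA mulrBr divff ?gt_eqF ?addr_gt0// mulr1 scale1r.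
  rewrite [1 + t - 1]addrAC subrr add0r scalerBr scalerDl scale1r addrCA.
  by rewrite [t *: y + _]addrC subrK.
Qed.

(** * The wall *)

Section Wall.
Variables (R : realType) (n d : nat) (h : 'M[R]_(d, n)) (k : 'M[R]_(n, n - d)).
Hypothesis hgeom : geometric_map h.
Hypothesis hgale : gale_transform h k.
Hypothesis sp : spanning h.
Variables (b0 : 'cV[R]_n) (x0 : 'cV[R]_d) (i : 'I_n).
Hypothesis ix : interior_point h b0 x0.
Local Notation Delta := (normal_fan h b0).
Local Notation I := (virtual_facets h b0).
Hypothesis Iu : forall j, I j -> untouched h b0 j.
Hypothesis sb0 : simple h b0.
Hypothesis hi : I i.

(* b0 with the i-th constraint pushed until it touches the polytope *)
Definition push : 'cV[R]_n :=
  \col_j (if j == i then - supp h b0 (col i h) else b0 j 0).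

Lemma push_i : push i 0 = - supp h b0 (col i h).
Proof. by rewrite mxE eqxx. Qed.

Lemma push_neq j : j != i -> push j 0 = b0 j 0.
Proof. by move=> /negbTE ji; rewrite mxE ji. Qed.

Lemma polyhedron_push : polyhedron h push = polyhedron h b0.
Proof.
apply/seteqP; split => x Px j; have [->|ji] := eqVneq j i.
- apply: le_trans (supp_col_ge sp i _) _.
    by exists x0; exact: interior_polyhedron.
  by have := Px i; rewrite push_i opprK.
- by have := Px j; rewrite push_neq.
- by rewrite push_i opprK supp_le.
- by rewrite push_neq.
Qed.

Lemma push_same : [/\ interior_point h push x0, normal_fan h push = Delta
  & virtual_facets h push = I].
Proof.
apply: same_polyhedron => //; first exact: polyhedron_push.
by move=> j nI; rewrite push_neq//; apply/eqP => ji; apply: nI; rewrite ji.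
Qed.

Lemma push_touched : touched h push i.
Proof.
have [y Py yi] := fan_complete (col i h) sp ix.
exists y; first by rewrite polyhedron_push.
by rewrite /active/slack/= push_i (suppE Py yi) subrr.
Qed.

Lemma push_active x j : j != i -> active h push x j = active h b0 x j.
Proof. by move=> ji; rewrite /active/slack/= push_neq. Qed.

Lemma push_untouched j : (I `\ i) j -> untouched h push j.
Proof.
move=> [Ij /eqP ji] x; rewrite polyhedron_push push_active//.
exact: Iu.
Qed.

Lemma push_nonslack j : ~ (I `\ i) j -> touched h push j.
Proof.
move=> nIj; have [->|/eqP ji] := eqVneq j i; first exact: push_touched.
apply: nonvirtual_touched => //; have [_ _ ->] := push_same.
by move=> Ij; apply: nIj.
Qed.

Lemma push_lift : Gamma_lift h Delta (I `\ i) push.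
Proof.
have [ipush <- Ipush] := push_same.
apply: (Gamma_lift_self hgeom sp ipush); last exact: push_nonslack.
by rewrite Ipush => j [].
Qed.

(** The truncation is applied to [push], which has the polytope and the fan of [b0]. Apart from [i],
    its tight constraints are those of [b0], so they stay independent. *)
Lemma exists_cut : exists (c : 'cV[R]_n) (e : R), [/\ 0 < e, c i 0 = push i 0 - e,
  forall j, j != i -> c j 0 = b0 j 0 & [/\ interior_point h c x0,
    normal_fan h c = star_subdivision Delta (col i h),
    virtual_facets h c = I `\ i & simple h c]].
Proof.
have [ipush fpush Ipush] := push_same.
have iv : virtual_facets h push i by rewrite Ipush.
have Iu' j : virtual_facets h push j -> j != i -> untouched h push j.
  by rewrite Ipush => Ij /eqP ji; apply: push_untouched.
have semi x (a : 'cV[R]_n) : polyhedron h push x -> exists v, forall j, j != i ->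
    active h push x j -> dotv v (col j h) = a j 0.
  rewrite polyhedron_push => Px; have [v Hv] := sb0 a Px.
  by exists v => j ji; rewrite push_active//; exact: Hv.
have [e e0 [[[ic fc] Ic] sc]] := near0_ex (filterI (filterI (filterI
  (near0_interior (- delta_mx i 0) ipush)
  (near0_star hgeom sp ipush push_touched))
  (near0_cut_virtual hgeom sp ipush push_touched Iu'))
  (near0_cut_simple hgeom sp ipush push_touched iv semi)).
exists (cut push i e), e; split => //.
- by rewrite /cut !mxE !eqxx mulrN1.
- by move=> j ji; rewrite /cut mxE push_neq// !mxE (negbTE ji) oppr0 mulr0 addr0.
- by rewrite -fpush -Ipush.
Qed.

(** The coefficients express [col i h] through the rays of the cone containing it, on which every
    function of [CSF Delta] is linear. *)
Lemma virtual_combination : exists l : 'I_n -> R, [/\ forall j, 0 <= l j,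
  forall j, I j -> l j = 0, col i h = \sum_j l j *: col j h &
  forall phi, CSF Delta phi -> phi (col i h) = \sum_j l j * phi (col j h)].
Proof.
have [y Py] := fan_complete (col i h) sp ix.
rewrite {1}(ncone_cone_of (irredundant hgeom ix) Py) => -[l [l0 ly lE]].
exists l; split => // [j Ij|phi F]; first by apply: ly => -[].
have [u Hu] := CSF_linear hgeom ix F Py.
rewrite Hu; last first.
  rewrite lE; apply: ncone_sum => j _.
  have [[_ yj]|/ly ->] := pselect ((~` I `&` active h b0 y) j); last first.
    by rewrite scale0r => z _; rewrite !dotv0r.
  by apply: ncone_ge0 => //; exact: active_ncone.
rewrite {1}lE dotvC dotv_sumr; apply: eq_bigr => j _.
have [[_ yj]|/ly ->] := pselect ((~` I `&` active h b0 y) j); last by rewrite !mul0r.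
by rewrite Hu ?(dotvC u)//; exact: active_ncone.
Qed.

(* The facet functional is the relation expressing h(e_i) through the rays of
   Delta, viewed as an element of ker h = k(R^(n-d)). *)
Lemma wall_functional : exists u : 'cV[R]_(n - d), (k *m u) i 0 = 1 /\
  forall (b : 'cV[R]_n) phi, CSF Delta phi -> (forall j, ~ I j -> phi (col j h) = - b j 0) ->
    dotv (k^T *m b) u = b i 0 + phi (col i h).
Proof.
have [l [l0 lI lE lphi]] := virtual_combination.
pose v : 'cV[R]_n := delta_mx i 0 - \col_j l j.
have : [set x | h *m x = 0] v.
  rewrite /= mulmxBr -colE lE; apply/eqP; rewrite subr_eq0; apply/eqP/colP => r.
  by rewrite summxE mxE; apply: eq_bigr => j _; rewrite !mxE mulrC.
rewrite -hgale.2 => -[u _ uE]; exists u; split.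
  by rewrite uE !mxE !eqxx lI// subr0.
move=> b phi F bE; rewrite dotv_gale uE dotvDr dotvNr lphi//; congr (_ + _).
  rewrite /dotv (bigD1 i)//= big1 => [|j ji]; rewrite !mxE ?eqxx ?mulr1 ?addr0//.
  by rewrite (negbTE ji) mulr0.
rewrite /dotv -sumrN; apply: eq_bigr => j _; rewrite mxE.
have [/lI ->|/bE ->] := pselect (I j); first by rewrite mulr0 mul0r oppr0.
by rewrite mulrN mulrC.
Qed.

(** The functional measures the gap between [phi (col i h)] and [- b i 0], which vanishes exactly
    when the inequality at [i] is an equality. *)
Lemma wall_face (u : 'cV[R]_(n - d)) :
  (forall (b : 'cV[R]_n) phi, CSF Delta phi -> (forall j, ~ I j -> phi (col j h) = - b j 0) ->
    dotv (k^T *m b) u = b i 0 + phi (col i h)) ->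
  (forall x, Gamma h k Delta I x -> 0 <= dotv x u) /\
  Gamma h k Delta (I `\ i) = [set x | Gamma h k Delta I x /\ dotv x u = 0].
Proof.
move=> Hu; split.
  move=> _ [b [phi F [bE bE']] <-]; rewrite (Hu _ _ F bE).
  by have := bE' i hi; lra.
apply/seteqP; split => chi.
  move=> [b [phi F [bE bE']] <-].
  have bI j : ~ I j -> phi (col j h) = - b j 0 by move=> nI; apply: bE => -[].
  have bi : phi (col i h) = - b i 0 by apply: bE => -[_]; apply.
  split; last by rewrite (Hu _ _ F bI) bi subrr.
  exists b => //; exists phi => //; split => // j Ij.
  have [->|/eqP ji] := eqVneq j i; first by rewrite bi.
  exact: bE'.
move=> [[b [phi F [bE bE']] <-]]; rewrite (Hu _ _ F bE) => bi.
exists b => //; exists phi => //; split => [j nIj|j [Ij _]]; last exact: bE'.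
have [->|/eqP ji] := eqVneq j i; first lra.
by apply: bE => Ij; apply: nIj.
Qed.

(** Simplicity leaves room around [b0] in all directions, so the cone has dimension n - d; on the
    wall, [push] can move in all directions orthogonal to [u]. *)
Lemma Gamma_facet : cone_facet (Gamma h k Delta I) (Gamma h k Delta (I `\ i)).
Proof.
have [u [ku Hu]] := wall_functional.
have [uge WE] := wall_face Hu.
split; first by exists u.
have u0 : u != 0.
  by apply/eqP => u0; move: ku; rewrite u0 mulmx0 mxE => /eqP; rewrite eq_sym oner_eq0.
have nd0 : (0 < n - d)%N.
  rewrite lt0n; apply: contra_neq u0 => E; apply/colP => -[j jm].
  by exfalso; move: jm; rewrite E.
have [S kS] := gale_right_inverse hgale.
have kSE (t : 'cV_(n - d)) : t = k^T *m (S *m t) by rewrite mulmxA kS mul1mx.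
have op a : \forall e \near 0^'+, Gamma_lift h Delta I (b0 + e *: a).
  by apply: (simple_open hgeom sp a ix sb0) => j; exact: nonvirtual_touched.
have lift0 : Gamma_lift h Delta I b0.
  by apply: (Gamma_lift_self hgeom sp ix) => // j; exact: nonvirtual_touched.
exists (n - d).-1; rewrite prednK//; split; split.
- have [B rB Bu] := hyperplane_basis u0.
  apply: (@dim_ge_near0 _ _ _ (k^T *m push) _ B) => //.
    by apply/(mem_Gamma hgale); exact: push_lift.
  move=> j; set t := col j B.
  apply: filterS (op (S *m t)) => e [phi F [bE bE']].
  rewrite [t]kSE scalemxAr -mulmxDr; apply/(mem_Gamma hgale).
  (* As [t] is orthogonal to [u], the gap at [i] is the same for [b0] and for its perturbation;
     passing from [b0] to [push] closes both. *)
  have pushE : push + e *: (S *m t) =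
      b0 + e *: (S *m t) - (b0 i 0 + supp h b0 (col i h)) *: delta_mx i 0.
    apply/colP => j'; rewrite !mxE eqxx andbT.
    by have [->|_] := eqVneq j' i; rewrite ?mulr1 ?mulr0; ring.
  have := Hu _ _ F bE; rewrite mulmxDr -scalemxAr -kSE dotvDl dotvZl Bu mulr0 addr0.
  rewrite (Hu _ _ (supp_CSF hgeom sp ix)); last first.
    by move=> l /(nonvirtual_touched hgeom)[y Py yl]; exact: supp_col_active yl.
  move=> phii; exists phi => //; split => [l nIl|l [Il /eqP li]].
    rewrite pushE 2![in RHS]mxE; have [->|/eqP li] := eqVneq l i.
      by rewrite !mxE !eqxx mulr1 phii; rewrite !mxE; ring.
    rewrite bE => [|Il]; last by apply: nIl.
    by move/eqP/negbTE: li => li; rewrite !mxE li mulr0 subr0.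
  apply: le_trans (bE' l Il); rewrite pushE.
  by rewrite !mxE (negbTE li) mulr0 subr0.
- move=> q [x Wx [A rA WA]].
  have uA : (u^T <= kermx A)%MS.
    rewrite sub_kermx; apply/eqP/rowP => j; rewrite [RHS]mxE.
    have := WA j; have := Wx; rewrite WE => -[_ xu] [_].
    by rewrite dotvDl xu add0r dotvC dotv_mx colE mulmxA -colE mxE.
  have := mxrankS uA; rewrite mxrank_ker rA rank_rV trmx_eq0 u0 subn_gt0 => qn.
  by rewrite -ltnS prednK.
- apply: (@dim_ge_near0 _ _ _ (k^T *m b0) _ 1%:M); rewrite ?mxrank1//.
    exact/(mem_Gamma hgale).
  move=> j; apply: filterS (op (S *m col j 1%:M)) => e.
  by move=> /(mem_Gamma hgale); rewrite mulmxDr -scalemxAr -kSE.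
- by move=> q; exact: dim_ge_leq.
Qed.

(** The point [chi] lies strictly between the image of [push] and another point of the wall, so
    [fan_segment] applies to each of its lifts. *)
Lemma wall_fan chi : relative_interior (Gamma h k Delta (I `\ i)) chi ->
  quantum_fan_at h k chi Delta I.
Proof.
move=> rchi.
have Wpush : Gamma h k Delta (I `\ i) (k^T *m push).
  by apply/(mem_Gamma hgale); exact: push_lift.
have [_ [s [[c cJ <-] /[dup] s01 /andP[s0 s1] chiE]]] := relative_interior_segment rchi Wpush.
have [ipush fpush Ipush] := push_same.
have main b : k^T *m b = chi -> [/\ full_polytope h b, normal_fan h b = Delta
    & virtual_facets h b = I].
  rewrite chiE !scalemxAr -mulmxDr => /esym/(gale_fiber hgale)[m bE].
  (* The translation is absorbed in the second endpoint, after division by its weight [s]. *)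
  have bE' : b = (1 - s) *: push + s *: (c + h^T *m (s^-1 *: m)).
    rewrite bE scalerDr -addrA; congr (_ + (_ + _)).
    by rewrite scalemxAr scalerA divff ?scale1r// gt_eqF.
  have := @fan_segment _ _ _ h hgeom sp push x0 (I `\ i)
    (c + h^T *m (s^-1 *: m)) s ipush.
  rewrite -bE' fpush Ipush; apply => //.
  - exact: push_untouched.
  - exact: push_nonslack.
  - by rewrite -fpush; apply: Gamma_lift_translate; rewrite fpush.
split => //.
have [b bchi] : exists b, k^T *m b = chi.
  by exists ((1 - s) *: push + s *: c); rewrite chiE mulmxDr !scalemxAr.
have [fb _ _] := main b bchi; have [y iy] := full_polytope_interior hgeom fb.
by rewrite -bchi; exact: interior_gale_cone iy.
Qed.

Lemma wall_between_star (c : 'cV[R]_n) (e : R) :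
  chamber h k (Gamma h k Delta I) -> 0 < e -> c i 0 = push i 0 - e ->
  (forall j, j != i -> c j 0 = b0 j 0) -> interior_point h c x0 ->
  normal_fan h c = star_subdivision Delta (col i h) ->
  virtual_facets h c = I `\ i -> simple h c ->
  wall_between h k (Gamma h k Delta (I `\ i)) (Gamma h k Delta I)
    (Gamma h k (normal_fan h c) (I `\ i)).
Proof.
move=> ch e0 ci cj ic fc Ic sc.
have cham : chamber h k (Gamma h k (normal_fan h c) (I `\ i)).
  rewrite -Ic; apply: (open_chamber hgeom hgale sp ic) => a.
  by apply: (simple_open hgeom sp a ic sc) => j; exact: nonvirtual_touched.
have [l [l0 lI lE lphi]] := virtual_combination.
have agree phi psi : CSF Delta phi -> CSF Delta psi ->
    (forall j, ~ I j -> phi (col j h) = psi (col j h)) ->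
    phi (col i h) = psi (col i h).
  move=> F G E; rewrite !lphi//; apply: eq_bigr => j _.
  by have [/lI ->|/E ->] := pselect (I j); rewrite ?mul0r.
have fsub y : polyhedron h c y ->
    exists2 x, polyhedron h b0 x & ncone h c y `<=` ncone h b0 x.
  move=> Py; have : normal_fan h c (ncone h c y) by rewrite (normal_fanE hgeom ic); exists y.
  rewrite fc (normal_fanE hgeom ix) => -[[[x Px ->] _]|]; first by exists x.
  move=> [t [_ _ [_ [[x Px ->] xi tx]] ->]]; exists x => //.
  move=> _ [v [r [/tx xv r0 ->]]]; apply: ncone_add => //.
  exact: ncone_ge0.
(* The chambers differ: if [c] lifted a point of the first, [- c i 0] would be at most
   [supp h b0 (col i h)], which it exceeds by [e]. *)
split => // [E|].
  have : Gamma h k Delta I (k^T *m c).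
    rewrite E; apply/(mem_Gamma hgale); rewrite -Ic.
    by apply: (Gamma_lift_self hgeom sp ic) => // j; exact: nonvirtual_touched.
  move=> /(mem_Gamma hgale)[phi F [cE cE']].
  have := cE' i hi; rewrite (agree _ _ F (supp_CSF hgeom sp ix)).
    by rewrite ci push_i; lra.
  move=> j nI; rewrite cE// cj; last by apply/eqP => ji; apply: nI; rewrite ji.
  by have [x Px xj] := nonvirtual_touched hgeom nI; rewrite (supp_col_active Px).
apply/seteqP; split => chi.
  move=> [b [phi F [bE bE']] <-]; split.
    exists b => //; exists phi => //; split => [j nI|j Ij]; first by apply: bE => -[].
    have [->|/eqP ji] := eqVneq j i; last exact: bE'.
    by rewrite bE// => -[_]; apply.
  exists b => //; exists phi => //.
  exact: (CSF_refine hgeom sp ix ic fsub).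
move=> [[b [phi F [bE bE']] <-]] /(mem_Gamma hgale)[psi G [pE pE']].
exists b => //; exists phi => //; split => [j nIj|j [Ij _]]; last exact: bE'.
have [->|/eqP ji] := eqVneq j i; last by apply: bE => Ij; apply: nIj.
(* The functions [phi] and [psi] agree on the rays of [Delta]; linearity of [phi] and
   superadditivity of [psi] bound [phi (col i h)] by [psi (col i h)], which is [- b i 0]. *)
apply/le_anti; rewrite bE'// andbT -pE => [|[_]]; last by apply.
rewrite lphi// lE.
apply: le_trans (CSF_sum hgeom sp ic xpredT (fun j => col j h) G l0).
apply: ler_sum => j' _; have [/lI ->|nI] := pselect (I j'); first by rewrite !mul0r.
by rewrite bE// pE// => -[].
Qed.

Lemma codimension_star c :
  interior_point h c x0 ->
  normal_fan h c = star_subdivision Delta (col i h) ->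
  virtual_facets h c = I `\ i ->
  codimension (exceptional_locus h k (normal_fan h c) (I `\ i) Delta I) 1.
Proof.
move=> ic fc Ic.
have subface j s t : Delta s -> Delta t -> s `<=` t ->
    cone_face s (ray (col j h)) -> cone_face t (ray (col j h)).
  rewrite (normal_fanE hgeom ix) => -[x Px ->] [y Py ->] xy xj.
  have [z Pz zE] := face_ncone Px xj; rewrite zE; apply: subcone_face => //.
  by rewrite -zE; case: xj => u _ -> w [/xy].
have [z [Pz zi zE]] : exists z, [/\ polyhedron h c z, active h c z i
    & ncone h c z = ray (col i h)].
  by apply/(nonvirtual_ray hgeom); rewrite Ic => -[_]; apply.
have [m mm zm] : exists2 m, maximal_cone (normal_fan h c) m & ncone h c z `<=` m.
  apply: (exists_maximal_cone hgeom ic (@subset_refl _ _)).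
  by rewrite (normal_fanE hgeom ic); exists z.
apply: (@codimension_coordinate _ _ _ h k _ _ _ _ i m) => //.
  split; first by move=> [_]; apply.
  have [y Py mE] : exists2 y, polyhedron h c y & m = ncone h c y.
    by case: mm => + _; rewrite (normal_fanE hgeom ic).
  by rewrite -zE mE; apply: subcone_face => //; rewrite -mE.
move=> v [[s [Ds _] sv] nv]; apply/eqP; apply: contrapT => /negP vi.
(* A common cone retaining all rays of [s] except that of [col i h] suffices: [s] itself if it omits
   [col i h], the base of the join otherwise. *)
suff [t [Dt Ct tv]] : exists t, [/\ Delta t, normal_fan h c t &
    forall j, j != i -> cone_rays h (I `\ i) s j -> cone_face t (ray (col j h))].
  apply: nv; have [|r [[Cr Dr] mr] tr] :=
    exists_maximal_cone hgeom ix (D := normal_fan h c `&` Delta) _ (conj Ct Dt).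
    by move=> ? [].
  exists r => // j; apply: contra_notP => /negP; rewrite negbK => vj.
  have ji : j != i by apply: contraTneq vj => ->.
  have : cone_rays h (I `\ i) s j.
    by apply: contrapT => /sv; rewrite vj.
  move=> /[dup] -[nIj _] /(tv j ji) tj; split; last exact: (subface _ _ _ Dt Dr tr tj).
  by move=> [//|Ij]; apply: nIj; split => //; exact/eqP.
move: Ds; rewrite {1}fc => -[[Ds si]|[t [Dt ti tin sE]]].
  exists s; split => //; first by rewrite fc; left.
  by move=> j _ [].
exists t; split => //; first by rewrite fc; left.
move=> j ji [_ [u uge rE]].
have t0 : t 0.
  by move: Dt; rewrite (normal_fanE hgeom ix) => -[y _ ->] z' _; rewrite !dotv0r.
have ts w : t w -> s w by move=> tw; rewrite sE; exists w, 0; rewrite scale0r addr0.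
have si : s (col i h) by rewrite sE; exists 0, 1; rewrite scale1r add0r.
(* A form cutting out the ray of [col j h] is positive on [col i h], so its zeros in the join lie in
   [t]. *)
have ui : 0 < dotv (col i h) u.
  rewrite lt_neqAle uge// andbT eq_sym; apply/eqP => ui.
  have : ray (col j h) (col i h) by rewrite rE.
  by move=> /(ray_inj hgeom) E; rewrite E eqxx in ji.
exists u; first by move=> w /ts; exact: uge.
rewrite rE; apply/seteqP; split => w [sw wu]; split => //; last exact: ts.
move: sw; rewrite sE => -[y [r [ty r0 wE]]]; move: wu; rewrite wE dotvDl dotvZl => E.
have /eqP : r * dotv (col i h) u = 0.
  by have := uge _ (ts _ ty); have := mulr_ge0 r0 (ltW ui); lra.
by rewrite mulf_eq0 (gt_eqF ui) orbF => /eqP ->; rewrite scale0r addr0.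
Qed.

End Wall.

(** Loosening the virtual constraints by 1 keeps the polytope, which the others define, and clears
    it of the loosened ones. *)
Lemma exists_slack (R : realType) (n d : nat) (h : 'M[R]_(d, n)) (b : 'cV[R]_n) :
  geometric_map h -> full_polytope h b ->
  exists b0 x0, [/\ interior_point h b0 x0, normal_fan h b0 = normal_fan h b,
    virtual_facets h b0 = virtual_facets h b
    & forall j, virtual_facets h b0 j -> untouched h b0 j].
Proof.
move=> hgeom fb; have [x0 ix] := full_polytope_interior hgeom fb.
pose b0 : 'cV[R]_n := \col_j (b j 0 + (`[< virtual_facets h b j >])%:R).
have Pb0 : polyhedron h b0 = polyhedron h b.
  apply/seteqP; split => x Px.
    apply/(irredundant hgeom ix) => j nv; have := (polyhedronE _ _ _).1 Px j.
    by rewrite /slack mxE asboolF// addr0.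
  apply/polyhedronE => j; have := (polyhedronE _ _ _).1 Px j.
  rewrite /slack mxE addrA => /le_trans; apply.
  by rewrite lerDl ler0n.
have nvE j : ~ virtual_facets h b j -> b0 j 0 = b j 0.
  by move=> nv; rewrite mxE asboolF// addr0.
have [ix0 f0 v0] := same_polyhedron hgeom Pb0 ix nvE.
exists b0, x0; split => // j; rewrite v0 => jv x; rewrite Pb0 => Px.
have := (polyhedronE _ _ _).1 Px j.
by rewrite /active/slack/= mxE asboolT// addrA => xj /eqP; rewrite gt_eqF// ltr_wpDl.
Qed.

Theorem theorem3p4p6 (R : realType) (n d : nat)
  (h : 'M[R]_(d, n)) (k : 'M[R]_(n, n - d))
  (hepi : forall y : 'cV[R]_d, exists x : 'cV[R]_n, h *m x = y)
  (hgeom : geometric_map h) (hgale : gale_transform h k)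
  (Delta : set (set 'cV[R]_d)) (I : set 'I_n)
  (hfan : polytopal_quantum_fan h Delta I)
  (hchamber : chamber h k (Gamma h k Delta I))
  (i : 'I_n) (hi : I i) :
  let Delta' := star_subdivision Delta (col i h) in
  let I' := I `\ i in
  let W := cone_product k (Gamma h k Delta set0) I' in
  (Gamma h k Delta I = cone_product k (Gamma h k Delta set0) I
   /\ direct_product k (Gamma h k Delta set0) I) /\
  cone_facet (Gamma h k Delta I) W /\
  (forall chi, relative_interior W chi -> quantum_fan_at h k chi Delta I) /\
  polytopal_quantum_fan h Delta' I' /\
  wall_between h k W (Gamma h k Delta I) (Gamma h k Delta' I') /\
  codimension (exceptional_locus h k Delta' I' Delta I) 1.
Proof.
have [b [fb DeltaE IE]] := hfan; have sp := full_polytope_spanning hgeom fb.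
have [b0 [x0 [ix]]] := exists_slack hgeom fb.
rewrite -DeltaE -IE => {DeltaE IE} DeltaE IE Iu.
rewrite -{}DeltaE -{}IE in hfan hchamber hi * => Delta' I' W.
have sb0 := chamber_simple hgeom hgale sp ix Iu hchamber.
have WE : W = Gamma h k (normal_fan h b0) I' by exact/esym/Gamma_cone_product.
have [c [e [e0 ci cj [ic fc vc sc]]]] := exists_cut hgeom sp ix Iu sb0 hi.
split; first split.
- exact: Gamma_cone_product.
- exact: (direct_productP hgale hgeom sp ix).
- rewrite WE; split; first exact: (Gamma_facet hgeom hgale sp ix sb0 hi).
  split; first by move=> chi; exact: (wall_fan hgeom hgale sp ix Iu hi).
  split; first by exists c; split; [exact: interior_full_polytope ic|exact/esym|exact/esym].
  rewrite /Delta' -fc; split.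
    exact: (wall_between_star hgeom hgale sp ix hi hchamber e0 ci cj ic fc vc sc).
  exact: (codimension_star _ hgeom ix hi ic fc vc).
Qed.
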